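(* There does not exist $(c,t,d,b,s)$, with $c \in \mathbb{R}^p$ such that $a$ and $c$ are linearly independent, $t \in \mathbb{R}$, $d>0$ and $(b,s) \in \mathcal{F}(d)$, such that the following three conditions all hold: (a) $E_{\beta,\sigma^2}\big(\text{length of } J(b,s)\big) \le E_{\beta,\sigma^2}\big(\text{length of } I\big)$ for all $(\beta,\sigma^2) \in \mathbb{R}^p \times (0,\infty)$; (b) $P_{\beta,\sigma^2}\big(\theta \in J(b,s)\big) \ge P_{\beta,\sigma^2}\big(\theta \in I\big)$ for all $(\beta,\sigma^2) \in \mathbb{R}^p \times (0,\infty)$; (c) strict inequality holds in either (a) or (b) for at least one $(\beta,\sigma^2)$.
   Context: Linear regression model: $Y = X\beta + \varepsilon$, where $Y$ is a random $n$-vector of responses, $X$ is a known $n \times p$ matrix with linearly independent columns, $\beta \in \mathbb{R}^p$ is an unknown parameter vector, and $\varepsilon \sim N(0,\sigma^2 I_n)$ with $\sigma^2>0$ unknown. Let $m = n-p \ge 1$. Let $\hat\beta$ be the least squares estimator of $\beta$ and $\hat\sigma^2 = (Y-X\hat\beta)^T(Y-X\hat\beta)/(n-p)$, $\hat\sigma = \sqrt{\hat\sigma^2}$. $P_{\beta,\sigma^2}$ and $E_{\beta,\sigma^2}$ denote probability and expectation under the parameter value $(\beta,\sigma^2)$. The parameter of interest is $\theta = a^T\beta$, where $a \in \mathbb{R}^p$, $a \neq 0$, is given. Let $\hat\Theta = a^T\hat\beta$. Fix $\alpha \in (0,1)$ and define $t(m)$ by $P(-t(m) \le T \le t(m)) =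 1-\alpha$ for $T \sim t_m$ (Student's $t$ distribution with $m$ degrees of freedom). For a vector $c \in \mathbb{R}^p$ such that $a$ and $c$ are linearly independent and a number $t \in \mathbb{R}$, let $\tau = c^T\beta - t$ and $\hat\tau = c^T\hat\beta - t$. Let $V = (v_{ij})$ be the $2\times 2$ covariance matrix of $(\hat\Theta,\hat\tau)$ divided by $\sigma^2$; in particular $v_{11} = \mathrm{Var}(\hat\Theta)/\sigma^2$ and $v_{22} = \mathrm{Var}(\hat\tau)/\sigma^2$. The usual $1-\alpha$ confidence interval for $\theta$ is $$I = \big[\hat\Theta - t(m)\sqrt{v_{11}}\,\hat\sigma,\ \hat\Theta + t(m)\sqrt{v_{11}}\,\hat\sigma\big].$$ For $d>0$, $\mathcal{F}(d)$ is the class of pairs of functions $(b,s)$ such that: $b:\mathbb{R}\to\mathbb{R}$ is odd; $s:[0,\infty)\to(0,\infty)$; both $b$ and $s$ are bounded and are continuous except, possibly, at a finite number of values; $b(x)=0$ for all $|x|\ge d$; and $s(x)=t(m)$ for all $x \ge d$. For given $c,t,d$ and $(b,s)\in\mathcal{F}(d)$, $J(b,s)$ is the confidence interval for $\theta$ with center $\hat\Theta - \sqrt{v_{11}}\,\hat\sigma\, b\big(\hat\tau/(\hat\sigma\sqrt{v_{22}})\big)$ and half-width $\sqrt{v_{11}}\,\hat\sigma\, s\big(|\hat\tau|/(\hat\sigma\sqrt{v_{22}})\big)$, i.e. the closed interval from center minus half-width to center plus half-width. (It depends on $c$ and $t$ through $\hat\tau$ and $v_{22}$.) *)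

(* Defs.v *)
From HB Require Import structures.
From mathcomp Require Import all_boot all_order all_algebra.
From mathcomp Require Import all_classical all_reals all_analysis.
Import Order.TTheory GRing.Theory Num.Theory.
Import numFieldNormedType.Exports.

Set Implicit Arguments.
Unset Strict Implicit.
Unset Printing Implicit Defensive.

Local Open Scope classical_set_scope.
Local Open Scope ring_scope.

Section student.
Context {R : realType}.

Definition euler_gamma (z : R) : R :=
  \int[lebesgue_measure]_(x in `]0, +oo[) (x `^ (z - 1) * expR (- x)).

Definition student_pdf (m : nat) (x : R) : R :=
  euler_gamma (m.+1%:R / 2) / (Num.sqrt (m%:R * pi) * euler_gamma (m%:R / 2))
  * (1 + x ^+ 2 / m%:R) `^ (- (m.+1%:R / 2)).

Definition student_prob (m : nat) (A : set R) : \bar R :=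
  (\int[lebesgue_measure]_(x in A) (student_pdf m x)%:E)%E.

End student.

Section model.
Context {d : measure_display} {Omega : measurableType d} {R : realType}.

(* eps ~ N(0, sigma^2 I_n): the law of eps agrees on measurable boxes with the
   n-fold product of N(0, sigma^2), i.e. the components are independent and
   N(0, sigma^2) distributed.  The second argument of [normal_prob] is the
   standard deviation. *)
Definition gaussian_noise {n : nat} (P : probability Omega R)
    (eps : Omega -> 'cV[R]_n) (sigma : R) : Prop :=
  (forall i, measurable_fun setT (fun w => eps w i 0)) /\
  (forall B : 'I_n -> set R, (forall i, measurable (B i)) ->
     P [set w | forall i, B i (eps w i 0)]
     = (\prod_(i < n) normal_prob 0%R sigma (B i))%E).

(* One sample space and one response vector Y carry the whole family of laws
   P beta sigma2; the law is constrained only for sigma2 > 0. *)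
Definition linear_regression {n p : nat} (X : 'M[R]_(n, p))
    (P : 'cV[R]_p -> R -> probability Omega R) (Y : Omega -> 'cV[R]_n) : Prop :=
  forall (beta : 'cV[R]_p) (sigma2 : R), 0 < sigma2 ->
    gaussian_noise (P beta sigma2) (fun w => Y w - X *m beta) (Num.sqrt sigma2).

Definition expected_length (P : probability Omega R)
    (J : Omega -> interval R) : \bar R :=
  (\int[P]_w lebesgue_measure [set` J w])%E.

Definition coverage (P : probability Omega R)
    (J : Omega -> interval R) (theta : R) : \bar R :=
  P [set w | theta \in J w].

(* A diagonal entry of "covariance matrix divided by sigma^2".  For linear
   functions of the least squares estimator the value does not depend on
   (beta, sigma2); this is a property of the model, not built in here. *)
Definition scaled_variance (P : probability Omega R) (sigma2 : R)
    (Z : Omega -> R) : R :=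
  fine (variance P Z) / sigma2.

End model.

Section estimators.
Context {R : realType} {n p : nat}.

Definition dotv {k : nat} (u v : 'cV[R]_k) : R := (u^T *m v) 0 0.

Definition is_least_squares (X : 'M[R]_(n, p)) (bhat : 'cV[R]_n -> 'cV[R]_p)
    : Prop :=
  forall (y : 'cV[R]_n) (b : 'cV[R]_p),
    dotv (y - X *m bhat y) (y - X *m bhat y) <= dotv (y - X *m b) (y - X *m b).

Definition sigmahat (X : 'M[R]_(n, p)) (bhat : 'cV[R]_n -> 'cV[R]_p)
    (y : 'cV[R]_n) : R :=
  Num.sqrt (dotv (y - X *m bhat y) (y - X *m bhat y) / (n - p)%:R).

Definition Thetahat (bhat : 'cV[R]_n -> 'cV[R]_p) (a : 'cV[R]_p)
    (y : 'cV[R]_n) : R :=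
  dotv a (bhat y).

Definition tauhat (bhat : 'cV[R]_n -> 'cV[R]_p) (c : 'cV[R]_p) (t : R)
    (y : 'cV[R]_n) : R :=
  dotv c (bhat y) - t.

Definition centered_itv (center halfwidth : R) : interval R :=
  `[center - halfwidth, center + halfwidth].

Definition usual_ci (X : 'M[R]_(n, p)) (bhat : 'cV[R]_n -> 'cV[R]_p)
    (a : 'cV[R]_p) (v11 tm : R) (y : 'cV[R]_n) : interval R :=
  centered_itv (Thetahat bhat a y) (tm * Num.sqrt v11 * sigmahat X bhat y).

Definition modified_ci (X : 'M[R]_(n, p)) (bhat : 'cV[R]_n -> 'cV[R]_p)
    (a c : 'cV[R]_p) (t v11 v22 : R) (b s : R -> R) (y : 'cV[R]_n)
    : interval R :=
  let sh := sigmahat X bhat y in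
  let th := tauhat bhat c t y in
  centered_itv
    (Thetahat bhat a y - Num.sqrt v11 * sh * b (th / (sh * Num.sqrt v22)))
    (Num.sqrt v11 * sh * s (`|th| / (sh * Num.sqrt v22))).

End estimators.

(* s is a function on [0, +oo[, encoded as a total function whose values on
   the negative reals are neither constrained nor used. *)
Definition class_F {R : realType} (tm d : R) (b s : R -> R) : Prop :=
  [/\ (forall x, b (- x) = - b x),
      (forall x, 0 <= x -> 0 < s x),
      (exists M, forall x, `|b x| <= M)
    & (exists M, forall x, 0 <= x -> s x <= M)] /\
  [/\ (exists D : set R, finite_set D /\
         forall x, ~ D x -> b y @[y --> x] --> b x),
      (exists D : set R, finite_set D /\
         forall x, 0 <= x -> ~ D x ->
           s y @[y --> within `[0, +oo[ (nbhs x)] --> s x),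
      (forall x, d <= `|x| -> b x = 0)
    & (forall x, d <= x -> s x = tm)].

(* Main.v *)
Require Import Defs.
From HB Require Import structures.
From mathcomp Require Import all_boot all_order all_algebra.
From mathcomp Require Import all_classical all_reals all_analysis.
From mathcomp Require Import measurable_realfun ring lra.

Set Implicit Arguments.
Unset Strict Implicit.
Unset Printing Implicit Defensive.

Import Order.TTheory GRing.Theory Num.Theory.
Import numFieldNormedType.Exports.

Local Open Scope classical_set_scope.
Local Open Scope ring_scope.

(** Take sigma = 1 and let beta run along the line u v, where v satisfies
    a^T v = 0 and c^T v = 1: then theta and sigma-hat do not see u, while
    tau-hat is translated by u.  The intervals I and J coincide as soon as
    the ratio x = tau-hat / (sigma-hat sqrt(v22)) leaves ]-d, d[, so
    conditions (a) and (b) survive restriction to that window and can be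
    integrated over all u in R, which amounts to a flat prior on tau.  By
    Tonelli the integration variable may be changed, for fixed data, from u
    to x; the price is a factor sigma-hat ([flat_prior_le]).

    The estimation error of Theta-hat, normalized, is a standard normal G
    independent of sigma-hat.  Here that independence is the statement that
    the component of a standard Gaussian vector along a unit vector can be
    resampled without changing the law ([std_gaussian_resample]); it follows
    from the Cameron-Martin formula ([cameron_martin]), whose density is
    multiplicative in the shift and hence needs a proof only for shifts along
    a coordinate axis.

    With x and w = const * sigma-hat fixed, coverage of J is the normal mass
    of the interval with center w b(x) and half-width w s(x), to be compared
    with [- w t(m), w t(m)].  The latter interval consists of the points where
    the normal density exceeds its value at w t(m), so it maximizes mass minus
    density(w t(m)) times length, and no other interval ties with it
    ([bathtub], [bathtub_eq]).  Averaged over sigma-hat and integrated in x,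
    this is the reverse of the combination of the integrated (a) and (b).
    Equality must therefore hold throughout, and b(x) = 0, s(|x|) = t(m) for
    almost every x ([interval_rigidity]).

    The law of the ratio charges no Lebesgue-null set ([ae_affine_ratio]), so
    J = I almost surely under every parameter value, which contradicts (c). *)

(** * Densities, images and integrals *)

Section density.
Local Open Scope ereal_scope.
Context {d : measure_display} {T : measurableType d} {R : realType}.

Import HBNNSimple.

(** Both sides are linear and continuous along increasing sequences in f, so the
    case of indicators, which is the hypothesis, propagates through simple
    functions. *)
Lemma ge0_integral_density (m nu : {measure set T -> \bar R}) (g : T -> R)
    (f : T -> \bar R) :
  measurable_fun setT g -> (forall x, 0 <= g x)%R ->
  (forall A, measurable A -> nu A = \int[m]_(x in A) (g x)%:E) ->
  measurable_fun setT f -> (forall x, 0 <= f x) ->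
  \int[nu]_x f x = \int[m]_x (f x * (g x)%:E).
Proof.
move=> mg g0 nuE mf f0.
pose f_ := nnsfun_approx measurableT mf.
have nnsfunE (h : {nnsfun T >-> R}) :
    \int[nu]_x (h x)%:E = \int[m]_x ((h x)%:E * (g x)%:E).
  under eq_integral do rewrite fimfunE -fsumEFin//.
  rewrite ge0_integral_fsum//; last 2 first.
  - by move=> r; exact/measurable_EFinP/measurable_funM.
  - by move=> r x _; rewrite nnfun_muleindic_ge0.
  under [RHS]eq_integral => x _.
    rewrite fimfunE -fsumEFin// ge0_mule_fsuml; last first.
      by move=> r; rewrite nnfun_muleindic_ge0.
    over.
  rewrite ge0_integral_fsum//; last 2 first.
  - move=> r; apply: emeasurable_funM; last exact/measurable_EFinP.
    exact/measurable_EFinP/measurable_funM.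
  - by move=> r x _; rewrite mule_ge0 ?nnfun_muleindic_ge0// lee_fin.
  apply: eq_fsbigr => r; rewrite inE => -[x _ <-].
  rewrite integralZl_indic_nnsfun// integral_indic// setIT nuE//.
  under [RHS]eq_integral do rewrite EFinM -(muleA _ _ (g _)%:E).
  rewrite ge0_integralZl//; last 3 first.
  - apply: emeasurable_funM; exact/measurable_EFinP.
  - by move=> y _; rewrite mule_ge0 ?lee_fin.
  - by rewrite lee_fin.
  congr (_ * _); rewrite integral_mkcond; apply: eq_integral => y _.
  by rewrite epatch_indic/= muleC.
transitivity (limn (fun n => \int[nu]_x (f_ n x)%:E)).
  rewrite -monotone_convergence//.
  - by apply: eq_integral => x _; apply/esym/cvg_lim => //; exact: cvg_nnsfun_approx.
  - by move=> n; exact/measurable_EFinP.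
  - by move=> n x _; rewrite lee_fin.
  - by move=> x _ a b ab; rewrite lee_fin; exact/lefP/nd_nnsfun_approx.
under [X in limn X]eq_fun do rewrite nnsfunE.
rewrite -monotone_convergence//.
- apply: eq_integral => x _; apply/cvg_lim => //.
  by apply: cvgeZr => //; exact: cvg_nnsfun_approx.
- by move=> n; apply: emeasurable_funM; exact/measurable_EFinP.
- by move=> n x _; rewrite mule_ge0 ?lee_fin.
- move=> x _ a b ab; apply: lee_wpmul2r; rewrite lee_fin//.
  exact/lefP/nd_nnsfun_approx.
Qed.

Section mdensity.
Variables (m : {measure set T -> \bar R}) (g : T -> R).
Hypotheses (mg : measurable_fun setT g) (g0 : forall x, (0 <= g x)%R).

(** The proofs that g is measurable and nonnegative are arguments: they let
    the measure structure be inferred from the term alone. *)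
Definition mdensity of measurable_fun setT g & (forall x, (0 <= g x)%R) :=
  fun A : set T => \int[m]_(x in A) (g x)%:E.

Local Notation nu := (mdensity mg g0).

Let nu0 : nu set0 = 0. Proof. exact: integral_set0. Qed.

Let nu_ge0 A : 0 <= nu A.
Proof. by apply: integral_ge0 => x _; rewrite lee_fin. Qed.

Let nu_sigma : semi_sigma_additive nu.
Proof.
apply: semi_sigma_additive_nng_induced; first exact/measurable_EFinP.
by move=> x; rewrite lee_fin.
Qed.

HB.instance Definition _ := isMeasure.Build _ _ _ nu nu0 nu_ge0 nu_sigma.

Lemma ge0_integral_mdensity (f : T -> \bar R) :
  measurable_fun setT f -> (forall x, 0 <= f x) ->
  \int[nu]_x f x = \int[m]_x (f x * (g x)%:E).
Proof. by move=> mf f0; apply: ge0_integral_density. Qed.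

End mdensity.

End density.

Section image.
Local Open Scope ereal_scope.
Context {d1 d2 : measure_display} {T1 : measurableType d1}
  {T2 : measurableType d2} {R : realType}.

(** The measurability proof is an argument, so that the pushforward comes with
    its measure structure. *)
Definition image_measure (m : {measure set T1 -> \bar R}) (phi : T1 -> T2)
    (mphi : measurable_fun setT phi) : {measure set T2 -> \bar R} :=
  measure_function_pushforward__canonical__measure_function_Measure m mphi.

Lemma ge0_integral_image (m : {measure set T1 -> \bar R})
    (nu : {measure set T2 -> \bar R}) (phi : T1 -> T2) (f : T2 -> \bar R) :
  measurable_fun setT phi ->
  (forall A, measurable A -> nu A = m (phi @^-1` A)) ->
  measurable_fun setT f -> (forall y, 0 <= f y) ->
  \int[nu]_y f y = \int[m]_x f (phi x).
Proof.
move=> mphi nuE mf f0.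
rewrite (eq_measure_integral (image_measure m mphi)); last by move=> A mA _; exact: nuE.
by rewrite ge0_integral_pushforward.
Qed.

End image.

Section integral_tools.
Local Open Scope ereal_scope.
Context {R : realType}.
Notation leb := (@lebesgue_measure R).

(** Scaling by k and translating multiplies the length of half-open intervals
    by k, and they determine Lebesgue measure. *)
Lemma ge0_integral_affine (k c : R) (F : R -> \bar R) :
  (0 < k)%R -> measurable_fun setT F -> (forall x, 0 <= F x) ->
  k%:E * \int[leb]_x F (k * x + c)%R = \int[leb]_x F x.
Proof.
move=> k0 mF F0.
pose phi : measurableTypeR R -> measurableTypeR R := fun x => (k * x + c)%R.
have mphi : measurable_fun setT phi.
  by apply: measurable_funD => //; exact: measurable_funM.
pose kn : {nonneg R} := NngNum (ltW k0).
have lebE A : measurable A -> leb A = mscale kn (image_measure leb mphi) A.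
  apply: lebesgue_measure_unique => _ [[a b]] _ <- /=.
  rewrite /mscale/= /pushforward.
  rewrite (_ : phi @^-1` _ = `]((a - c) / k)%R, ((b - c) / k)%R]%classic); last first.
    apply/seteqP; split => x /=; rewrite !in_itv/= /phi => /andP[h1 h2].
      by rewrite ltr_pdivrMr// ler_pdivlMr// mulrC ltrBlDr lerBrDr h1 h2.
    by move: h1 h2; rewrite ltr_pdivrMr// ler_pdivlMr// ![(x * k)%R]mulrC ltrBlDr lerBrDr => -> ->.
  rewrite !lebesgue_measure_itv/= !lte_fin ltr_pM2r ?invr_gt0// ltrD2r.
  case: ifPn => _; last by rewrite mule0.
  rewrite -!EFinB -EFinM; congr EFin.
  by field; rewrite gt_eqF.
rewrite -[k]/(kn%:num).
have -> : \int[leb]_x F (k * x + c)%R = \int[image_measure leb mphi]_x F x.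
  by rewrite (ge0_integral_image (m := leb) (phi := phi)).
rewrite -ge0_integral_mscale//.
by apply: eq_measure_integral => A mA _; exact: (esym (lebE _ mA)).
Qed.

End integral_tools.

Section ae_tools.
Local Open Scope ereal_scope.
Context {d : measure_display} {T : measurableType d} {R : realType}.
Variable mu : {measure set T -> \bar R}.

(** The gap g - f is nonnegative over every measurable E and over its
    complement, while its total over D is at most zero; as the integrals are
    finite it vanishes over E. *)
Lemma ge0_le_integral_ae_eq (D : set T) (f g : T -> \bar R) :
  measurable D -> measurable_fun D f -> measurable_fun D g ->
  (forall x, D x -> 0 <= f x) -> (forall x, D x -> f x <= g x) ->
  \int[mu]_(x in D) g x <= \int[mu]_(x in D) f x ->
  \int[mu]_(x in D) f x < +oo -> ae_eq mu D f g.
Proof.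
move=> mD mf mg f0 fg gf foo.
have g0 x : D x -> 0 <= g x by move=> Dx; rewrite (le_trans (f0 _ Dx))// fg.
have intf : mu.-integrable D f.
  apply/integrableP; split => //.
  rewrite (eq_integral f)// => x /set_mem Dx.
  by rewrite gee0_abs// f0.
apply: integral_ae_eq => // E ED mE.
have mDE : measurable (D `\` E) by exact: measurableD.
have le_on A : measurable A -> A `<=` D -> \int[mu]_(x in A) f x <= \int[mu]_(x in A) g x.
  move=> mA AD; apply: ge0_le_integral => //.
  - by move=> x /AD; exact: f0.
  - exact: measurable_funS mf.
  - exact: measurable_funS mg.
  - by move=> x /AD; exact: fg.
have splitE (h : T -> \bar R) : measurable_fun D h -> (forall x, D x -> 0 <= h x) ->
    \int[mu]_(x in D) h x = \int[mu]_(x in E) h x + \int[mu]_(x in D `\` E) h x.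
  move=> mh h0; rewrite -ge0_integral_setU//.
  - by rewrite setDUK.
  - by rewrite setDUK.
  - by move=> x; rewrite setDUK//; exact: h0.
  - by rewrite disj_set2E setDIK.
apply/eqP; rewrite eq_le le_on//=.
have fin : \int[mu]_(x in D `\` E) f x \is a fin_num.
  rewrite ge0_fin_numE; last by apply: integral_ge0 => x [/f0].
  by apply: le_lt_trans foo; exact: ge0_subset_integral.
rewrite -(leeD2rE _ _ fin) -splitE//.
apply: le_trans gf; rewrite splitE//.
by apply: leeD2l; apply: le_on => //; exact: subDsetl.
Qed.

End ae_tools.

Section real_line.
Context {R : realType}.
Notation leb := (@lebesgue_measure R).

(** A nonempty open interval has positive length, so it is not contained in the
    exceptional null set. *)
Lemma ae_lebesgue_itv_witness (P : R -> Prop) (a b : R) :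
  {ae leb, forall x, P x} -> a < b -> exists2 x, a < x < b & P x.
Proof.
move=> [N [mN N0 PN]] ab; apply: contrapT => nex.
have sub : `]a, b[ `<=` N.
  move=> x /=; rewrite in_itv/= => xab; apply: PN => /= Px.
  by apply: nex; exists x.
have : (leb `]a, b[%classic <= leb N)%E by apply: le_measure; rewrite ?inE.
rewrite N0 lebesgue_measure_itv/= lte_fin ab -EFinB lee_fin subr_le0.
by rewrite leNgt ab.
Qed.

Lemma measurable_fun_finite_discontinuity (f : R -> R) (D : set R) :
  finite_set D -> (forall x, ~ D x -> {for x, continuous f}) ->
  measurable_fun setT f.
Proof.
move=> finD cf.
have mD (A : set R) : A `<=` D -> measurable A.
  move=> AD; apply: countable_measurable; first by move=> t; exact: measurable_set1.
  by apply: finite_set_countable; exact: sub_finite_set finD.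
rewrite -(setUv D); apply/measurable_funU; [exact: mD|by apply: measurableC; apply: mD|split].
  by move=> _ Y _; apply: mD => x [].
apply: open_continuous_measurable_fun.
  apply: closed_openC; apply: (proj1 accessible_finite_set_closed) => //.
  exact: hausdorff_accessible.
by move=> x; rewrite inE => /= nDx; exact: cf.
Qed.

Lemma measurable_fun_bool_indicator (d : measure_display) (T : measurableType d) (p : T -> bool) :
  measurable_fun setT p -> measurable_fun setT (fun x => (p x)%:R : R).
Proof.
move=> mp; rewrite (_ : (fun _ => _) = (fun x => if p x then 1 else 0)).
  by apply: measurable_fun_ifT => //; exact: measurable_cst.
by apply/funext => x; case: (p x).
Qed.

End real_line.

(** * Column vectors as a measurable space *)

Section column_space.
Context {R : realType} {n : nat}.

Definition box (B : 'I_n -> set R) : set 'cV[R]_n :=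
  [set y | forall i, B i (y i 0)].

Definition boxes : set (set 'cV[R]_n) :=
  [set A | exists2 B, (forall i, measurable (B i)) & A = box B].

(* The product sigma-algebra: boxes are the sets on which the law of the noise
   is prescribed, and they are stable under intersection. *)
HB.instance Definition _ := @isMeasurable.Build (sigma_display boxes)
  'cV[R]_n <<s boxes >> (@sigma_algebra0 _ setT boxes) (@sigma_algebraC _ boxes)
  (@sigma_algebra_bigcup _ setT boxes).

Lemma measurable_box (B : 'I_n -> set R) :
  (forall i, measurable (B i)) -> measurable (box B).
Proof. by move=> mB; apply: sub_sigma_algebra; exists B. Qed.

Lemma boxT : box (fun=> setT) = setT.
Proof. by apply/seteqP; split. Qed.

Lemma boxes_setI : setI_closed boxes.
Proof.
move=> _ _ [A mA ->] [B mB ->]; exists (fun i => A i `&` B i).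
  by move=> i; exact: measurableI.
apply/seteqP; split=> y; first by move=> [yA yB] i; split; [exact: yA|exact: yB].
by move=> yAB; split=> i; have [] := yAB i.
Qed.

(** Boxes form a pi-system that contains the whole space. *)
Lemma measure_unique_boxes (m1 m2 : {measure set 'cV[R]_n -> \bar R}) :
  (m1 setT < +oo)%E ->
  (forall B, (forall i, measurable (B i)) -> m1 (box B) = m2 (box B)) ->
  forall A, measurable A -> m1 A = m2 A.
Proof.
move=> m1oo m12 A mA; apply: (measure_unique boxes (fun=> setT)) => //.
- exact: boxes_setI.
- by move=> _; exists (fun=> setT) => //; rewrite boxT.
- by rewrite bigcup_const.
- by move=> _ [B mB ->]; exact: m12.
Qed.

Lemma measurable_coord (i : 'I_n) : measurable_fun setT (fun y : 'cV[R]_n => y i 0).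
Proof.
move=> _ A mA; rewrite setTI.
rewrite (_ : _ @^-1` A = box (fun j => if j == i then A else setT)).
  by apply: measurable_box => j; case: ifP.
apply/seteqP; split => y /=; last by move/(_ i); rewrite eqxx.
by move=> Ay j; case: eqP => // ->.
Qed.

Lemma measurable_fun_column d (T : measurableType d) (f : T -> 'cV[R]_n) :
  (forall i, measurable_fun setT (fun x => f x i 0)) -> measurable_fun setT f.
Proof.
move=> mf; apply: (@measurability _ _ _ _ _ _ boxes) => //.
move=> _ [_ [B mB ->] <-].
rewrite (_ : _ `&` _ = \bigcap_(i in [set: 'I_n]) (setT `&` (fun x => f x i 0) @^-1` B i)).
  apply: fin_bigcap_measurable => // i _; exact: mf.
apply/seteqP; split => x /=; first by move=> [_ h] i _; split => //; exact: h.
by move=> h; split => // i; have [] := h i I.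
Qed.

End column_space.

(** * Standard normal and standard Gaussian laws *)

Section standard_normal.
Context {R : realType}.
Notation leb := (@lebesgue_measure R).
Notation gauss := (normal_prob (0 : R) 1).

Definition phi (x : R) : R := normal_pdf 0 1 x.

Lemma phiE x : phi x = normal_peak 1 * expR (- x ^+ 2 / 2).
Proof.
rewrite /phi normal_pdfE ?oner_eq0// /normal_fun subr0 expr1n.
by rewrite -[1 *+ 2]/(2 : R).
Qed.

Lemma phi_gt0 x : 0 < phi x.
Proof. by rewrite phiE mulr_gt0 ?expR_gt0// normal_peak_gt0// oner_eq0. Qed.

Lemma phi_ge0 x : 0 <= phi x. Proof. exact/ltW/phi_gt0. Qed.

Lemma measurable_phi : measurable_fun setT phi.
Proof. exact: measurable_normal_pdf. Qed.

Lemma phi_lt x y : `|x| < `|y| -> phi y < phi x.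
Proof.
move=> xy; rewrite !phiE ltr_pM2l ?normal_peak_gt0 ?oner_eq0// ltr_expR.
rewrite ltr_pM2r// ltrN2 -(real_normK (num_real x)) -(real_normK (num_real y)).
by rewrite ltr_pXn2r// ?nnegrE.
Qed.

Lemma phi_le x y : `|x| <= `|y| -> phi y <= phi x.
Proof.
rewrite le_eqVlt => /orP[/eqP xy|/phi_lt/ltW//].
by rewrite !phiE -(real_normK (num_real x)) xy (real_normK (num_real y)).
Qed.

(** The one-dimensional Cameron-Martin density: an exponential tilt of the
    normal density is a translate of it. *)
Lemma phi_shift h x : phi x * expR (h * x - h ^+ 2 / 2) = phi (x - h).
Proof. by rewrite !phiE -mulrA -expRD; congr (_ * expR _); field. Qed.

Lemma phiN x : phi (- x) = phi x.
Proof. by rewrite !phiE sqrrN. Qed.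

Lemma integral_phi : (\int[leb]_x (phi x)%:E = 1)%E.
Proof. exact: integral_normal_pdf. Qed.

Lemma ge0_integral_std_normal (f : R -> \bar R) :
  measurable_fun setT f -> (forall x, 0 <= f x)%E ->
  (\int[gauss]_x f x = \int[leb]_x (f x * (phi x)%:E))%E.
Proof.
by move=> mf f0; apply: ge0_integral_density => //; [exact: measurable_phi|exact: phi_ge0].
Qed.

End standard_normal.

Section std_gaussian.
Local Open Scope ereal_scope.
Context {R : realType} {n : nat}.
Notation leb := (@lebesgue_measure R).
Notation gauss := (normal_prob (0 : R) 1).
Implicit Types (mu : probability 'cV[R]_n R) (B : 'I_n -> set R).

Definition std_gaussian mu := forall B, (forall i, measurable (B i)) ->
  mu (box B) = \prod_(i < n) gauss (B i).

Definition upd B (i : 'I_n) (A : set R) : 'I_n -> set R :=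
  fun j => if j == i then A else B j.

Lemma measurable_upd B i A : (forall j, measurable (B j)) -> measurable A ->
  forall j, measurable (upd B i A j).
Proof. by move=> mB mA j; rewrite /upd; case: ifP. Qed.

Lemma std_gaussian_upd mu B i A : std_gaussian mu ->
  (forall j, measurable (B j)) -> measurable A ->
  mu (box (upd B i A)) = gauss A * \prod_(j < n | j != i) gauss (B j).
Proof.
move=> muN mB mA; rewrite muN; last exact: measurable_upd.
rewrite (bigD1 i)//= {1}/upd eqxx; congr (_ * _).
by apply: eq_bigr => j; rewrite /upd => /negbTE ->.
Qed.

Lemma box_upd B i A : box (upd B i A) =
  box (upd B i setT) `&` (fun y : 'cV[R]_n => y i 0%R) @^-1` A.
Proof.
apply/seteqP; split=> y.
  move=> yB; split; last by have := yB i; rewrite /upd eqxx.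
  by move=> j; have := yB j; rewrite /upd; case: eqP.
by move=> [yB yA] j; have := yB j; rewrite /upd; case: eqP => [->|].
Qed.

(** Independence of the coordinate i from the event that the others lie in the
    box B: the measure of events in y_i restricted to that event is a multiple
    of the one-dimensional normal law. *)
Lemma std_gaussian_coord mu B i (k : R -> \bar R) : std_gaussian mu ->
  (forall j, measurable (B j)) -> measurable_fun setT k -> (forall x, 0 <= k x) ->
  \int[mu]_(y in box (upd B i setT)) k (y i 0%R) =
  \int[gauss]_x k x * \prod_(j < n | j != i) gauss (B j).
Proof.
move=> muN mB mk k0.
set D := box (upd B i setT).
have mD : measurable D by apply: measurable_box; exact: measurable_upd.
pose r := (\prod_(j < n | j != i) fine (gauss (B j)))%R.
have r0 : (0 <= r)%R by apply: prodr_ge0 => j _; exact: fine_ge0.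
have rE : \prod_(j < n | j != i) gauss (B j) = r%:E.
  rewrite -prodEFin; apply: eq_bigr => j _.
  by rewrite fineK//; exact: (@fin_num_measure _ _ _ gauss _ (mB j)).
have mind : measurable_fun setT (\1_D : 'cV[R]_n -> R) by exact: measurable_indic.
have ind0 (y : 'cV[R]_n) : (0 <= (\1_D y : R))%R by [].
pose muD := mdensity mu mind ind0.
pose kr : {nonneg R} := NngNum r0.
have muDE A : measurable A ->
    mscale kr gauss A = muD ((fun y : 'cV[R]_n => y i 0%R) @^-1` A).
  move=> mA; have mCA : measurable ((fun y : 'cV[R]_n => y i 0%R) @^-1` A).
    by rewrite -[X in measurable X]setTI; exact: measurable_coord.
  rewrite /muD /mdensity integral_indic//.
  rewrite (_ : D `&` _ = box (upd B i A)); last by rewrite [RHS]box_upd.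
  rewrite [X in _ = X](std_gaussian_upd i muN mB mA) rE /mscale/= muleC//.
have mkc : measurable_fun setT (fun y : 'cV[R]_n => k (y i 0%R)).
  by apply: measurableT_comp => //; exact: measurable_coord.
transitivity (\int[muD]_y k (y i 0%R)).
  rewrite (ge0_integral_mdensity mu mind ind0 mkc)// [LHS]integral_mkcond.
  by apply: eq_integral => y _; rewrite epatch_indic.
rewrite -(ge0_integral_image (m := muD) (nu := mscale kr gauss))//; last exact: measurable_coord.
by rewrite ge0_integral_mscale//= rE muleC.
Qed.

End std_gaussian.

(** * The Cameron-Martin formula and resampling of one direction *)

Section dot_product.
Context {R : realType} {n : nat}.
Implicit Types u v w : 'cV[R]_n.

Lemma dotvE u v : dotv u v = \sum_i u i 0 * v i 0.
Proof. by rewrite /dotv mxE; apply: eq_bigr => i _; rewrite mxE. Qed.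

Lemma dotvC u v : dotv u v = dotv v u.
Proof. by rewrite !dotvE; apply: eq_bigr => i _; rewrite mulrC. Qed.

Lemma dotvDr u v w : dotv u (v + w) = dotv u v + dotv u w.
Proof. by rewrite /dotv mulmxDr mxE. Qed.

Lemma dotvDl u v w : dotv (v + w) u = dotv v u + dotv w u.
Proof. by rewrite dotvC dotvDr !(dotvC u). Qed.

Lemma dotvZr a u v : dotv u (a *: v) = a * dotv u v.
Proof. by rewrite /dotv -scalemxAr mxE. Qed.

Lemma dotvZl a u v : dotv (a *: u) v = a * dotv u v.
Proof. by rewrite dotvC dotvZr dotvC. Qed.

Lemma dotvNr u v : dotv u (- v) = - dotv u v.
Proof. by rewrite -scaleN1r dotvZr mulN1r. Qed.

Lemma dotvBr u v w : dotv u (v - w) = dotv u v - dotv u w.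
Proof. by rewrite dotvDr dotvNr. Qed.

Lemma dotvBl u v w : dotv (v - w) u = dotv v u - dotv w u.
Proof. by rewrite dotvC dotvBr !(dotvC u). Qed.

Lemma dotv0r u : dotv u 0 = 0.
Proof. by rewrite -(scale0r u) dotvZr mul0r. Qed.

Lemma dotv0l u : dotv 0 u = 0. Proof. by rewrite dotvC dotv0r. Qed.

Lemma dotv_ge0 u : 0 <= dotv u u.
Proof. by rewrite dotvE sumr_ge0// => i _; rewrite -expr2 sqr_ge0. Qed.

Lemma dotv_eq0 u : (dotv u u == 0) = (u == 0).
Proof.
apply/idP/eqP => [|->]; last by rewrite dotv0r.
rewrite dotvE psumr_eq0 => [/allP u0|i _]; last by rewrite -expr2 sqr_ge0.
apply/colP => i; rewrite mxE; apply/eqP.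
by have := u0 i (mem_index_enum _); rewrite mulf_eq0 orbb.
Qed.

Lemma dotv_delta i v : dotv (delta_mx i 0) v = v i 0.
Proof.
rewrite dotvE (bigD1 i)//= mxE !eqxx mul1r big1 ?addr0// => j /negbTE ji.
by rewrite mxE ji mul0r.
Qed.

End dot_product.

Section measurability.
Context {R : realType} {n : nat} {d : measure_display} {T : measurableType d}.
Implicit Types f g : T -> 'cV[R]_n.

Lemma measurable_column_coord f i : measurable_fun setT f ->
  measurable_fun setT (fun x => f x i 0).
Proof. move=> mf; exact: (measurableT_comp (measurable_coord i) mf). Qed.

Lemma measurable_column_add f g : measurable_fun setT f -> measurable_fun setT g ->
  measurable_fun setT (fun x => f x + g x).
Proof.
move=> mf mg; apply: measurable_fun_column => i.
rewrite (_ : (fun x => _) = (fun x => f x i 0 + g x i 0)).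
  by apply: measurable_funD; exact: measurable_column_coord.
by apply/funext => x; rewrite mxE.
Qed.

Lemma measurable_column_scale (a : T -> R) f : measurable_fun setT a ->
  measurable_fun setT f -> measurable_fun setT (fun x => a x *: f x).
Proof.
move=> ma mf; apply: measurable_fun_column => i.
rewrite (_ : (fun x => _) = (fun x => a x * f x i 0)).
  by apply: measurable_funM => //; exact: measurable_column_coord.
by apply/funext => x; rewrite mxE.
Qed.

Lemma measurable_column_mul k (A : 'M[R]_(k, n)) f : measurable_fun setT f ->
  measurable_fun setT (fun x => A *m f x).
Proof.
move=> mf; apply: measurable_fun_column => i.
rewrite (_ : (fun x => _) = (fun x => \sum_j A i j * f x j 0)).
  apply: measurable_sum => j; apply: measurable_funM => //.
  exact: measurable_column_coord.
by apply/funext => x; rewrite mxE.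
Qed.

Lemma measurable_dotv f g : measurable_fun setT f -> measurable_fun setT g ->
  measurable_fun setT (fun x => dotv (f x) (g x)).
Proof.
move=> mf mg; rewrite (_ : (fun x => _) = (fun x => \sum_j f x j 0 * g x j 0)).
  apply: measurable_sum => j.
  by apply: measurable_funM => //; exact: measurable_column_coord.
by apply/funext => x; rewrite dotvE.
Qed.

End measurability.

Section cameron_martin.
Local Open Scope ereal_scope.
Context {R : realType} {n : nat} (mu : probability 'cV[R]_n R).
Hypothesis muN : std_gaussian mu.
Notation leb := (@lebesgue_measure R).
Notation gauss := (normal_prob (0 : R) 1).

(** Both sides integrate f against a measure, so it is enough to compare boxes;
    there the other coordinates contribute the same factor and [phi_shift]
    settles coordinate i. *)
Lemma cameron_martin_coord (i : 'I_n) (h : R) (f : 'cV[R]_n -> \bar R) :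
  measurable_fun setT f -> (forall y, 0 <= f y) ->
  \int[mu]_y f (y + h *: delta_mx i 0)%R =
  \int[mu]_y (f y * (expR (h * y i 0 - h ^+ 2 / 2))%:E).
Proof.
move=> mf f0.
pose e (t : R) := expR (h * t - h ^+ 2 / 2).
have me : measurable_fun setT e.
  apply: measurableT_comp => //; apply: measurable_funB => //.
have mei : measurable_fun setT (fun y : 'cV[R]_n => e (y i 0%R)).
  by apply: measurableT_comp => //; exact: measurable_coord.
have e0 (y : 'cV[R]_n) : (0 <= e (y i 0))%R by exact: expR_ge0.
pose tr := fun y : 'cV[R]_n => (y + h *: delta_mx i 0)%R.
have mtr : measurable_fun setT tr.
  by apply: measurable_column_add => //; exact: measurable_cst.
rewrite -(ge0_integral_mdensity mu mei e0 mf)//.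
rewrite -(ge0_integral_image (m := mu) (nu := image_measure mu mtr) mtr)//.
apply: eq_measure_integral => A mA _.
apply: measure_unique_boxes => // [|B mB].
  by rewrite /= /pushforward preimage_setT;
    apply: (le_lt_trans (probability_le1 _ measurableT)); exact: ltry.
rewrite /= /pushforward.
have mshift : measurable ((fun t => t + h)%R @^-1` B i).
  by rewrite -[X in measurable X]setTI; apply: measurable_funD.
rewrite (_ : tr @^-1` box B = box (upd B i ((fun t => t + h)%R @^-1` B i))); last first.
  apply/seteqP; split => y /= yB j; have := yB j; rewrite /upd /tr !mxE;
    by have [->|ji] := eqVneq j i; rewrite /= ?mulr1 ?mulr0 ?addr0.
rewrite [LHS](std_gaussian_upd i muN mB mshift).
have -> : box B = box (upd B i (B i)).
  by congr box; apply/funext => j; rewrite /upd; case: eqP => [->|].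
rewrite /mdensity box_upd integral_mkcondr.
pose k (t : R) := (e t)%:E * (\1_(B i) t)%:E.
have mk : measurable_fun setT k.
  apply: emeasurable_funM; apply/measurable_EFinP => //.
have k0 t : 0 <= k t by rewrite mule_ge0 ?lee_fin ?expR_ge0.
transitivity (\int[mu]_(y in box (upd B i setT)) k (y i 0%R)); last first.
  by apply: eq_integral => y _; rewrite epatch_indic.
rewrite [RHS](std_gaussian_coord i muN mB mk k0); congr (_ * _).
rewrite ge0_integral_std_normal//.
pose F (t : R) := (\1_(B i) t)%:E * (phi (t - h))%:E.
have mF : measurable_fun setT F.
  apply: emeasurable_funM; apply/measurable_EFinP; first exact: (measurable_indic (mB i)).
  by apply: measurableT_comp; [exact: measurable_phi|exact: measurable_funB].
transitivity (\int[leb]_t F t); last first.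
  apply: eq_integral => t _; rewrite /F /k -(phi_shift h) -/(e t).
  by rewrite -!EFinM; congr EFin; ring.
rewrite -(ge0_integral_affine (k := 1%R) h)// ?mul1e; last first.
  by move=> t; rewrite mule_ge0 ?lee_fin ?phi_ge0.
rewrite [LHS]integral_mkcond; apply: eq_integral => t _.
by rewrite epatch_indic /F mul1r addrK muleC /= -/(phi t).
Qed.

(** If the formula holds for two shifts it holds for their sum, because the cross
    term of the density is exactly the value of the first exponent at the second
    shift.  So shifts along the axes suffice. *)
Lemma cameron_martin (h : 'cV[R]_n) (f : 'cV[R]_n -> \bar R) :
  measurable_fun setT f -> (forall y, 0 <= f y) ->
  \int[mu]_y f (y + h)%R =
  \int[mu]_y (f y * (expR (dotv h y - dotv h h / 2))%:E).
Proof.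
move: f; have -> : h = (\sum_i h i 0 *: delta_mx i 0)%R.
  rewrite [LHS]matrix_sum_delta; apply: eq_bigr => i _.
  by rewrite big_ord1.
apply: (big_ind (fun h : 'cV[R]_n => forall f : 'cV[R]_n -> \bar R,
    measurable_fun setT f -> (forall y, 0 <= f y) ->
    \int[mu]_y f (y + h)%R =
    \int[mu]_y (f y * (expR (dotv h y - dotv h h / 2))%:E))).
- move=> f mf f0; apply: eq_integral => y _.
  by rewrite addr0 !dotv0l mul0r subrr expR0 mule1.
- move=> h1 h2 IH1 IH2 f mf f0.
  have mfh2 : measurable_fun setT (fun y : 'cV[R]_n => f (y + h2)%R).
    by apply: measurableT_comp => //; apply: measurable_column_add.
  have me (k : 'cV[R]_n) (c : R) :
      measurable_fun setT (fun y : 'cV[R]_n => (expR (dotv k y - c))%:E).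
    apply/measurable_EFinP; apply: measurableT_comp => //.
    by apply: measurable_funB => //; apply: measurable_dotv => //; exact: measurable_cst.
  transitivity (\int[mu]_y (f (y + h2)%R * (expR (dotv h1 y - dotv h1 h1 / 2))%:E)).
    rewrite -(IH1 (fun y : 'cV[R]_n => f (y + h2)%R))//.
    by apply: eq_integral => y _; rewrite -addrA.
  pose F (y : 'cV[R]_n) := f y * (expR (dotv h1 y - (dotv h1 h2 + dotv h1 h1 / 2)))%:E.
  transitivity (\int[mu]_y F (y + h2)%R).
    apply: eq_integral => y _; rewrite /F dotvDr; congr (_ * (expR _)%:E).
    by ring.
  rewrite IH2; last 2 first.
  - by apply: emeasurable_funM.
  - by move=> y; rewrite mule_ge0 ?lee_fin ?expR_ge0.
  apply: eq_integral => y _; rewrite /F -muleA -EFinM -expRD.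
  congr (_ * (expR _)%:E); rewrite !dotvDl !dotvDr (dotvC h2 h1).
  by field.
- move=> i _ f mf f0.
  transitivity (\int[mu]_y (f y * (expR (h i 0%R * y i 0%R - h i 0%R ^+ 2 / 2))%:E)).
    exact: (cameron_martin_coord i (h i 0%R) mf f0).
  apply: eq_integral => y _; rewrite !dotvZl dotvZr !dotv_delta mxE !eqxx.
  by rewrite mulr1 expr2.
Qed.

End cameron_martin.

Section disintegration.
Local Open Scope ereal_scope.
Context {R : realType} {n : nat} (mu : probability 'cV[R]_n R).
Hypothesis muN : std_gaussian mu.
Notation leb := (@lebesgue_measure R).
Notation gauss := (normal_prob (0 : R) 1).

(** The component of y along the unit vector q may be replaced by an independent
    standard normal l.  To see it, insert the factor 1 written as the integral
    over l of phi (l - <q, y>), exchange the integrals and, for each l, use the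
    Cameron-Martin formula for the shift l q: the normal density reappears with
    argument <q, y> + l, and translating l gives the right-hand side. *)
Lemma std_gaussian_resample (q : 'cV[R]_n) (f : 'cV[R]_n -> \bar R) :
  dotv q q = 1%R -> measurable_fun setT f -> (forall y, 0 <= f y) ->
  \int[mu]_y f y =
  \int[mu]_y \int[leb]_l (f (y + (l - dotv q y) *: q)%R * (phi l)%:E).
Proof.
move=> q1 mf f0.
have mdot d (T : measurableType d) (g : T -> 'cV[R]_n) : measurable_fun setT g ->
    measurable_fun setT (fun x => dotv q (g x)).
  by move=> mg; apply: measurable_dotv => //; exact: measurable_cst.
have mphic d (T : measurableType d) (g : T -> R) : measurable_fun setT g ->
    measurable_fun setT (fun x => (phi (g x))%:E).
  by move=> mg; apply/measurable_EFinP; apply: measurableT_comp => //; exact: measurable_phi.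
have phi0 x : 0 <= (phi x)%:E :> \bar R by rewrite lee_fin phi_ge0.
transitivity (\int[mu]_y \int[leb]_l (f y * (phi (l - dotv q y))%:E)).
  apply: eq_integral => y _; rewrite ge0_integralZl//; last first.
    by apply: mphic; exact: measurable_funB.
  have := ge0_integral_affine (k := 1%R) (- dotv q y) ltr01
    (mphic _ _ idfun (@measurable_id _ _ setT)) (fun x => phi0 x).
  rewrite mul1e integral_phi => h.
  rewrite (_ : \int[leb]_l _ = 1) ?mule1// -[RHS]h.
  by apply: eq_integral => l _; rewrite mul1r.
pose H (p : 'cV[R]_n * R) := f p.1 * (phi (p.2 - dotv q p.1))%:E.
have mH : measurable_fun setT H.
  apply: emeasurable_funM; first exact: measurableT_comp.
  by apply: mphic; apply: measurable_funB => //; exact: mdot.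
have H0 p : 0 <= H p by rewrite mule_ge0.
transitivity (\int[leb]_l \int[mu]_y (f y * (phi (l - dotv q y))%:E)).
  exact: (fubini_tonelli (m1 := mu) (m2 := leb) H mH H0).
transitivity (\int[leb]_l \int[mu]_y (f (y + l *: q)%R * (phi (dotv q y + l))%:E)).
  apply: eq_integral => l _.
  pose F (y : 'cV[R]_n) := f y * (phi (dotv q y))%:E.
  transitivity (\int[mu]_y F (y + l *: q)%R); last first.
    by apply: eq_integral => y _; rewrite /F dotvDr dotvZr q1 mulr1.
  rewrite (cameron_martin muN)//; last 2 first.
  - by apply: emeasurable_funM => //; apply: mphic; exact: mdot.
  - by move=> y; rewrite mule_ge0.
  apply: eq_integral => y _; rewrite /F -muleA -EFinM; congr (_ * _%:E).
  by rewrite !dotvZl dotvZr q1 mulr1 -expr2 phi_shift -phiN opprB.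
pose K (p : 'cV[R]_n * R) := f (p.1 + p.2 *: q)%R * (phi (dotv q p.1 + p.2))%:E.
have mK : measurable_fun setT K.
  apply: emeasurable_funM.
    apply: measurableT_comp => //; apply: measurable_column_add => //.
    by apply: measurable_column_scale => //; exact: measurable_cst.
  by apply: mphic; apply: measurable_funD => //; exact: mdot.
have K0 p : 0 <= K p by rewrite mule_ge0.
transitivity (\int[mu]_y \int[leb]_l (f (y + l *: q)%R * (phi (dotv q y + l))%:E)).
  exact: (esym (fubini_tonelli (m1 := mu) (m2 := leb) K mK K0)).
apply: eq_integral => y _.
pose G l := f (y + (l - dotv q y) *: q)%R * (phi l)%:E.
rewrite -[RHS](ge0_integral_affine (k := 1%R) (dotv q y) (F := G))//.
- by rewrite mul1e; apply: eq_integral => l _; rewrite /G mul1r addrK (addrC l).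
- apply: emeasurable_funM; last exact: mphic.
  apply: measurableT_comp => //; apply: measurable_column_add; first exact: measurable_cst.
  apply: measurable_column_scale; last exact: measurable_cst.
  exact: measurable_funB.
- by move=> l; rewrite /G mule_ge0.
Qed.

(** Linear functionals are normal: resample along r; the remaining integrand is
    constant in y. *)
Lemma std_gaussian_dotv (r : 'cV[R]_n) (f : R -> \bar R) :
  r != 0%R -> measurable_fun setT f -> (forall y, 0 <= f y) ->
  \int[mu]_y f (dotv r y) =
  \int[gauss]_l f (Num.sqrt (dotv r r) * l)%R.
Proof.
move=> r0 mf f0; set k := Num.sqrt _.
have rr0 : (0 < dotv r r)%R by rewrite lt_neqAle dotv_ge0 eq_sym dotv_eq0 r0.
have k0 : (0 < k)%R by rewrite sqrtr_gt0.
have kk : (k ^+ 2 = dotv r r)%R by rewrite sqr_sqrtr// dotv_ge0.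
pose q := (k^-1 *: r)%R.
have q1 : dotv q q = 1%R by rewrite dotvZl dotvZr -kk; field; rewrite gt_eqF.
have rE : r = (k *: q)%R by rewrite scalerA divff ?scale1r// gt_eqF.
rewrite (std_gaussian_resample q1); last 2 first.
- by apply: measurableT_comp => //; apply: measurable_dotv => //; exact: measurable_cst.
- by move=> y; exact: f0.
have mfk : measurable_fun setT (fun l : R => f (k * l)%R).
  by apply: measurableT_comp => //; exact: measurable_funM.
rewrite ge0_integral_std_normal//.
transitivity (\int[mu]_y (cst (\int[leb]_l (f (k * l)%R * (phi l)%:E)) y)).
  apply: eq_integral => y _; apply: eq_integral => l _.
  congr (f _ * _); rewrite {1}rE dotvZl dotvDr dotvZr q1 mulr1.
  by rewrite addrC subrK.
by rewrite integral_cst//= [X in _ * X]probability_setT mule1.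
Qed.

End disintegration.

Section moments.
Local Open Scope ereal_scope.
Context {R : realType}.
Notation leb := (@lebesgue_measure R).
Notation gauss := (normal_prob (0 : R) 1).

(** The second moment of the standard normal law, kept symbolic and shown to be
    finite and positive. *)
Definition gauss_sqr : R := fine (\int[gauss]_x (x ^+ 2)%:E).

Let msqr : measurable_fun setT (fun x : R => (x ^+ 2)%:E).
Proof. by apply/measurable_EFinP; exact: measurable_funX. Qed.

(** x^2 exp(-x^2/2) is at most 4 exp(-x^2/4), a multiple of the density of the
    normal law of variance 2. *)
Lemma gauss_sqr_lty : \int[gauss]_x (x ^+ 2)%:E < +oo.
Proof.
rewrite ge0_integral_std_normal//; last by move=> x; rewrite lee_fin sqr_ge0.
pose s : R := Num.sqrt 2.
have s0 : s != 0%R by rewrite gt_eqF// sqrtr_gt0.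
have s2 : (s ^+ 2 = 2)%R by rewrite sqr_sqrtr.
pose C : R := (4 * normal_peak 1 / normal_peak s)%R.
have ps : (0 < normal_peak s)%R by exact: normal_peak_gt0.
have C0 : (0 <= C)%R by rewrite divr_ge0 ?mulr_ge0 ?normal_peak_ge0.
apply: (@le_lt_trans _ _ (\int[leb]_x (C%:E * (normal_pdf 0 s x)%:E))).
  apply: ge0_le_integral => //.
  - by move=> x _; rewrite mule_ge0 ?lee_fin ?sqr_ge0 ?phi_ge0.
  - apply: emeasurable_funM => //; apply/measurable_EFinP; exact: measurable_phi.
  - apply: emeasurable_funM => //; apply/measurable_EFinP; exact: measurable_normal_pdf.
  - move=> x _; rewrite -!EFinM lee_fin phiE normal_pdfE// /normal_fun subr0 s2.
    rewrite (_ : (C * _ = normal_peak 1 * (4 * expR (- x ^+ 2 / (2 *+ 2)))))%R; last first.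
      by rewrite /C; field; rewrite gt_eqF.
    rewrite mulrCA ler_pM2l ?normal_peak_gt0 ?oner_eq0//.
    have -> : (- x ^+ 2 / 2 = - x ^+ 2 / (2 *+ 2) + - x ^+ 2 / (2 *+ 2))%R by field.
    rewrite expRD mulrA ler_pM2r ?expR_gt0//.
    have h := expR_ge1Dx (x ^+ 2 / 4).
    have -> : (- x ^+ 2 / (2 *+ 2) = - (x ^+ 2 / 4))%R by rewrite mulNr -mulr_natr -natrM.
    rewrite expRN ler_pdivrMr ?expR_gt0//.
    have := sqr_ge0 x; lra.
rewrite ge0_integralZl//.
- by rewrite integral_normal_pdf mule1 ltry.
- by apply/measurable_EFinP; exact: measurable_normal_pdf.
- by move=> x _; rewrite lee_fin normal_pdf_ge0.
Qed.

Lemma gauss_sqrE : \int[gauss]_x (x ^+ 2)%:E = gauss_sqr%:E.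
Proof.
rewrite /gauss_sqr fineK// ge0_fin_numE ?gauss_sqr_lty//.
by apply: integral_ge0 => x _; rewrite lee_fin sqr_ge0.
Qed.

Lemma gauss_sqr_gt0 : (0 < gauss_sqr)%R.
Proof.
have ge0 : 0 <= gauss_sqr%:E.
  by rewrite -gauss_sqrE; apply: integral_ge0 => x _; rewrite lee_fin sqr_ge0.
rewrite lt_neqAle -lee_fin ge0 andbT eq_sym; apply/negP => /eqP e0.
have := gauss_sqrE; rewrite e0 ge0_integral_std_normal//; last first.
  by move=> x; rewrite lee_fin sqr_ge0.
have mf : measurable_fun setT (fun x : R => (x ^+ 2)%:E * (phi x)%:E).
  by apply: emeasurable_funM => //; apply/measurable_EFinP; exact: measurable_phi.
move=> i0.
have : \int[leb]_x `|(x ^+ 2)%:E * (phi x)%:E| = 0.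
  rewrite -[RHS]i0; apply: eq_integral => x _.
  by rewrite gee0_abs// mule_ge0 ?lee_fin ?sqr_ge0 ?phi_ge0.
move/(ae_eq_integral_abs leb measurableT mf) => ae0.
have [x /andP[x0 _] /(_ I)] := ae_lebesgue_itv_witness ae0 (@ltr01 R).
rewrite /= -EFinM => -[] /eqP.
by rewrite mulf_eq0 sqrf_eq0 (gt_eqF x0) (gt_eqF (phi_gt0 x)).
Qed.

End moments.

(** * Least squares *)

Section least_squares.
Context {R : realType} {n p : nat}.
Variables (X : 'M[R]_(n, p)) (bhat : 'cV[R]_n -> 'cV[R]_p).
Hypotheses (Xfree : row_free X^T) (bhatP : is_least_squares X bhat).

Lemma dotv_mulmx m k (A : 'M[R]_(m, k)) u v : dotv u (A *m v) = dotv (A^T *m u) v.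
Proof. by rewrite /dotv trmx_mul trmxK mulmxA. Qed.

(** Orthogonality of the residual e to each X h: otherwise moving the estimate
    by (<e, X h> / |X h|^2) h would decrease the sum of squares by
    <e, X h>^2 / |X h|^2. *)
Lemma least_squares_normal_eq y : X^T *m (y - X *m bhat y) = 0.
Proof.
set e := y - X *m bhat y.
suff orth h : dotv e (X *m h) = 0.
  by apply/eqP; rewrite -dotv_eq0 -dotv_mulmx orth.
have [->|/negbTE Xh0] := eqVneq (X *m h) 0; first exact: dotv0r.
set c := dotv _ _; set N := dotv (X *m h) (X *m h).
have N0 : 0 < N by rewrite lt_neqAle dotv_ge0 eq_sym dotv_eq0 Xh0.
have := bhatP y (bhat y + (c / N) *: h).
rewrite mulmxDr -scalemxAr opprD addrA -/e; move: e @c => e c.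
rewrite !dotvBl !dotvBr !dotvZl !dotvZr.
rewrite (dotvC (X *m h) e) -/c -/N => hle.
have : c ^+ 2 / N <= 0.
  have -> : c ^+ 2 / N = c / N * c by rewrite expr2 mulrAC.
  have e1 : c / N * N = c by rewrite divfK// gt_eqF.
  by move: hle; rewrite e1; lra.
by rewrite pmulr_lle0 ?invr_gt0// => c2; apply/eqP; rewrite -sqrf_eq0 eq_le c2 sqr_ge0.
Qed.

Lemma gram_unit : X^T *m X \in unitmx.
Proof.
rewrite -row_free_unit; apply: inj_row_free => v vG.
have : dotv (X *m v^T) (X *m v^T) = 0.
  rewrite dotv_mulmx; apply/eqP; rewrite dotvC.
  rewrite (_ : X^T *m (X *m v^T) = 0) ?dotv0r//.
  by rewrite mulmxA -[X^T *m X]trmxK trmx_mul trmxK -trmx_mul vG trmx0.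
move/eqP; rewrite dotv_eq0 => /eqP Xv.
apply/eqP; rewrite -(mulmx_free_eq0 _ Xfree) -[_ *m _]trmxK trmx_mul trmxK Xv.
by rewrite trmx0.
Qed.

Definition lsq_mx : 'M[R]_(p, n) := invmx (X^T *m X) *m X^T.

Lemma bhatE y : bhat y = lsq_mx *m y.
Proof.
have := least_squares_normal_eq y; rewrite mulmxBr => /subr0_eq.
by rewrite /lsq_mx -!mulmxA => ->; rewrite (mulmxA X^T) mulKmx// gram_unit.
Qed.

Lemma lsq_mxK : lsq_mx *m X = 1%:M.
Proof. by rewrite /lsq_mx -mulmxA mulVmx// gram_unit. Qed.

Lemma bhat_shift y b : bhat (y + X *m b) = bhat y + b.
Proof.
by rewrite !bhatE mulmxDr mulmxA lsq_mxK mul1mx.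
Qed.

Lemma bhat_scale k y : bhat (k *: y) = k *: bhat y.
Proof. by rewrite !bhatE -scalemxAr. Qed.

(** The vector of the column space of X that represents the linear form
    y |-> a^T bhat(y). *)
Definition lsq_dual (a : 'cV[R]_p) : 'cV[R]_n := lsq_mx^T *m a.

Lemma dotv_bhat a y : dotv a (bhat y) = dotv (lsq_dual a) y.
Proof. by rewrite bhatE dotv_mulmx. Qed.

Lemma lsq_dual_mulmx a b : dotv (lsq_dual a) (X *m b) = dotv a b.
Proof. by rewrite -dotv_mulmx mulmxA lsq_mxK mul1mx. Qed.

Lemma lsq_dual_neq0 a : a != 0 -> lsq_dual a != 0.
Proof.
apply: contra_neq => a0.
apply/eqP; rewrite -dotv_eq0 -lsq_dual_mulmx a0; exact/eqP/dotv0l.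
Qed.

Definition resid y : 'cV[R]_n := y - X *m bhat y.

Lemma resid_shift y b : resid (y + X *m b) = resid y.
Proof. by rewrite /resid bhat_shift mulmxDr opprD addrACA subrr addr0. Qed.

Lemma resid_scale k y : resid (k *: y) = k *: resid y.
Proof. by rewrite /resid bhat_scale -scalemxAr scalerBr. Qed.

Lemma resid_shift_dual y k a : resid (y + k *: lsq_dual a) = resid y.
Proof.
rewrite /lsq_dual /lsq_mx trmx_mul trmxK -mulmxA scalemxAr.
exact: resid_shift.
Qed.

Lemma dotv_resid_le y : dotv (resid y) (resid y) <= dotv y y.
Proof. by have := bhatP y 0; rewrite mulmx0 subr0. Qed.

Lemma resid_eq0_dotv y e : X^T *m e = 0 -> resid y = 0 -> dotv e y = 0.
Proof.
move=> Xe /subr0_eq ->; rewrite dotv_mulmx Xe; exact: dotv0l.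
Qed.

End least_squares.

Lemma orthogonal_column_exists (R : realType) (n p : nat) (X : 'M[R]_(n, p)) :
  (p < n)%N -> exists2 e : 'cV[R]_n, e != 0 & X^T *m e = 0.
Proof.
move=> pn.
have : kermx X != 0.
  rewrite -mxrank_eq0 mxrank_ker -lt0n subn_gt0.
  exact: leq_ltn_trans (rank_leq_col X) pn.
move=> /rowV0Pn[u /sub_kermxP uX u0].
exists u^T; last by rewrite -trmx_mul uX trmx0.
by apply: contra_neq u0 => u0; rewrite -[u]trmxK u0 trmx0.
Qed.

(** Take for v a multiple of the component of c orthogonal to a. *)
Lemma free2_dual (R : realType) (p : nat) (a c : 'cV[R]_p) : free [:: a; c] ->
  exists2 v : 'cV[R]_p, dotv a v = 0 & dotv c v = 1.
Proof.
rewrite free_cons span_seq1 => /andP[ac]; rewrite seq1_free => c0.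
have a0 : a != 0 by apply: contraNneq ac => ->; exact: mem0v.
have aa : dotv a a != 0 by rewrite dotv_eq0.
pose k := dotv a c / dotv a a.
pose u := c - k *: a.
have au : dotv a u = 0 by rewrite dotvBr dotvZr /k divfK// subrr.
have u0 : u != 0.
  apply/eqP => /subr0_eq cE.
  have k0 : k != 0 by apply: contraNneq c0 => k0; rewrite cE k0 scale0r.
  by move/negP: ac; apply; rewrite cE; apply/vlineP; exists k^-1; rewrite scalerA mulVf// scale1r.
have uu : dotv u u != 0 by rewrite dotv_eq0.
exists ((dotv u u)^-1 *: u); first by rewrite dotvZr au mulr0.
have -> : c = u + k *: a by rewrite subrK.
by rewrite dotvZr dotvDl dotvZl au mulr0 addr0 mulVf.
Qed.

(** * The bathtub inequality for intervals *)

(** Inversion is continuous except at 0, where the convention 0^-1 = 0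
    applies. *)
Lemma measurable_fun_inv (d : measure_display) (T : measurableType d)
    (R : realType) (f : T -> R) :
  measurable_fun setT f -> measurable_fun setT (fun x => (f x)^-1).
Proof.
apply: measurableT_comp; apply: (@measurable_fun_finite_discontinuity _ _ [set 0]).
  exact: finite_set1.
by move=> x /eqP x0; exact: inv_continuous.
Qed.

Lemma measurable_fun_div (d : measure_display) (T : measurableType d)
    (R : realType) (f g : T -> R) :
  measurable_fun setT f -> measurable_fun setT g ->
  measurable_fun setT (fun x => f x / g x).
Proof. by move=> mf mg; apply: measurable_funM => //; exact: measurable_fun_inv. Qed.

Section bathtub.
Local Open Scope ereal_scope.
Context {R : realType}.
Notation leb := (@lebesgue_measure R).

(** Indicator at x of the closed interval of center c and half-width h, as a real
    number; in this form it is jointly measurable in the three arguments. *)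
Definition itv_ind (c h x : R) : R := (`|x - c| <= h)%R%:R.

Lemma itv_ind_ge0 c h x : (0 <= itv_ind c h x)%R. Proof. exact: ler0n. Qed.

Lemma measurable_itv_ind (d : measure_display) (T : measurableType d) (c h x : T -> R) :
  measurable_fun setT c -> measurable_fun setT h -> measurable_fun setT x ->
  measurable_fun setT (fun y => itv_ind (c y) (h y) (x y)).
Proof.
move=> mc mh mx; apply: measurable_fun_bool_indicator.
apply: measurable_fun_ler => //; apply: measurableT_comp => //.
exact: measurable_funB.
Qed.

Lemma integral_itv_ind (c h : R) : (0 <= h)%R -> \int[leb]_x (itv_ind c h x)%:E = (2 * h)%:E.
Proof.
move=> h0; rewrite (_ : (fun x => _) = (fun x => (\1_`[(c - h)%R, (c + h)%R] x)%:E)).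
  rewrite integral_indic//= setIT lebesgue_measure_itv/= lte_fin.
  have [hlt|] := ltP (c - h)%R (c + h)%R; first by rewrite -EFinB; congr EFin; ring.
  by move=> hge; congr EFin; lra.
by apply/funext => x; rewrite /itv_ind indicE mem_setE in_itv/= ler_distl.
Qed.

Definition gauss_mass (c h : R) := \int[leb]_x (itv_ind c h x * phi x)%:E.

Lemma gauss_mass_ge0 c h : 0 <= gauss_mass c h.
Proof. by apply: integral_ge0 => x _; rewrite lee_fin mulr_ge0 ?itv_ind_ge0 ?phi_ge0. Qed.

Let minb c h : measurable_fun setT (itv_ind c h).
Proof. by apply: measurable_itv_ind. Qed.

Lemma gauss_mass_le1 c h : gauss_mass c h <= 1.
Proof.
rewrite -(@integral_phi R); apply: ge0_le_integral => //.
- by move=> x _; rewrite lee_fin mulr_ge0 ?itv_ind_ge0 ?phi_ge0.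
- apply/measurable_EFinP/measurable_funM; [exact: minb|exact: measurable_phi].
- by apply/measurable_EFinP; exact: measurable_phi.
- move=> x _; rewrite lee_fin ler_piMl ?phi_ge0//.
  by rewrite /itv_ind lern1 leq_b1.
Qed.

(* The integrand of a mass plus phi(t) times a length: phi 1_A + phi(t) 1_B, for
   the intervals A and B of centers c, c' and half-widths h, h'. *)
Let side (c h c' h' t x : R) := (itv_ind c h x * phi x + phi t * itv_ind c' h' x)%R.

Let side_ge0 c h c' h' t x : (0 <= side c h c' h' t x)%R.
Proof. by rewrite addr_ge0// mulr_ge0 ?itv_ind_ge0 ?phi_ge0. Qed.

Let mside c h c' h' t : measurable_fun setT (side c h c' h' t).
Proof.
apply: measurable_funD; apply: measurable_funM => //; exact: measurable_phi.
Qed.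

Let integral_side (c h c' h' t : R) : (0 <= h')%R ->
  \int[leb]_x (side c h c' h' t x)%:E = gauss_mass c h + (phi t * (2 * h'))%:E.
Proof.
move=> h'0; under eq_integral do rewrite EFinD.
rewrite ge0_integralD//.
- congr (_ + _); rewrite EFinM -(integral_itv_ind c')// -ge0_integralZl//.
  + by apply/measurable_EFinP; exact: minb.
  + by move=> x _; rewrite lee_fin itv_ind_ge0.
  + by rewrite lee_fin phi_ge0.
- by move=> x _; rewrite lee_fin mulr_ge0 ?itv_ind_ge0 ?phi_ge0.
- apply/measurable_EFinP/measurable_funM; [exact: minb|exact: measurable_phi].
- by move=> x _; rewrite lee_fin mulr_ge0 ?itv_ind_ge0 ?phi_ge0.
- by apply/measurable_EFinP/measurable_funM => //; exact: minb.
Qed.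

(* The difference of the two sides is
   (phi x - phi t) (1_[-t, t] x - 1_A x), a product of two factors of the same
   sign since phi x >= phi t exactly on [-t, t]. *)
Let side_le (c h t x : R) : (0 <= t)%R -> (side c h 0 t t x <= side 0 t c h t x)%R.
Proof.
move=> t0.
rewrite -subr_ge0 (_ : (_ - _ = (phi x - phi t) * (itv_ind 0 t x - itv_ind c h x))%R); last first.
  by rewrite /side; ring.
rewrite {1}/itv_ind subr0; have [xt|tx] := leP `|x|%R t.
  rewrite mulr_ge0 ?subr_ge0 ?phi_le ?(ger0_norm t0)//.
  by rewrite /itv_ind lern1 leq_b1.
rewrite sub0r mulrN -mulNr opprB mulr_ge0 ?itv_ind_ge0// subr_ge0.
by rewrite phi_le// (ger0_norm t0) ltW.
Qed.

(** Since [-t, t] is the set where the density is at least phi(t), removing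
    points from it or adding points to it lowers mass minus phi(t) times
    length. *)
Lemma bathtub (c h t : R) : (0 <= t)%R -> (0 <= h)%R ->
  gauss_mass c h + (phi t * (2 * t))%:E <= gauss_mass 0 t + (phi t * (2 * h))%:E.
Proof.
move=> t0 h0; rewrite -(integral_side c h 0 t t0) -(integral_side 0 t c t h0).
apply: ge0_le_integral => //.
- by move=> x _; rewrite lee_fin side_ge0.
- by apply/measurable_EFinP; exact: mside.
- by apply/measurable_EFinP; exact: mside.
- by move=> x _; rewrite lee_fin side_le.
Qed.

(** Equality forces the indicators of the two intervals to agree almost
    everywhere off the points +t and -t, where phi differs from phi(t).  If an
    endpoint of one interval differed from that of the other, a nondegenerate
    open interval would contradict this. *)
Lemma bathtub_eq (c h t : R) : (0 < t)%R -> (0 < h)%R ->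
  gauss_mass 0 t + (phi t * (2 * h))%:E <= gauss_mass c h + (phi t * (2 * t))%:E ->
  c = 0%R /\ h = t.
Proof.
move=> t0 h0; have [t0' h0'] := (ltW t0, ltW h0).
rewrite -(integral_side c h 0 t t0') -(integral_side 0 t c t h0') => hle.
have ae_in : {ae leb, forall x, `|x|%R != t -> itv_ind c h x = itv_ind 0 t x}.
  have /(_ measurableT) : forall mD : measurable [set: R], ae_eq leb setT
      (fun x => (side c h 0 t t x)%:E) (fun x => (side 0 t c h t x)%:E).
    move=> mT; apply: ge0_le_integral_ae_eq => //.
    - by apply/measurable_EFinP; exact: mside.
    - by apply/measurable_EFinP; exact: mside.
    - by move=> x _; rewrite lee_fin side_ge0.
    - by move=> x _; rewrite lee_fin side_le.
    - rewrite integral_side//; apply: lte_add_pinfty; last exact: ltry.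
      by apply: le_lt_trans (gauss_mass_le1 _ _) _; exact: ltry.
  apply: filterS => x /(_ I) [] e xt.
  have : ((phi x - phi t) * (itv_ind c h x - itv_ind 0 t x) = 0)%R.
    transitivity (side c h 0 t t x - side 0 t c h t x)%R; last by rewrite e subrr.
    by rewrite /side; ring.
  move/eqP; rewrite mulf_eq0 => /orP[|]; last by rewrite subr_eq0 => /eqP.
  have [xlt|xgt|xeq] := ltgtP `|x|%R t.
  - by rewrite gt_eqF// subr_gt0 phi_lt// (gtr0_norm t0).
  - by rewrite lt_eqF// subr_lt0 phi_lt// (gtr0_norm t0).
  - by rewrite xeq eqxx in xt.
have contra a b' : (a < b')%R ->
    (forall x, a < x < b' -> `|x| != t /\ itv_ind c h x != itv_ind 0 t x)%R -> False.
  move=> ab hx; have [x xab /= hi] := ae_lebesgue_itv_witness ae_in ab.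
  have [xt] := hx x xab.
  by rewrite hi// eqxx.
have inbE c' h' x : itv_ind c' h' x = ((c' - h' <= x) && (x <= c' + h'))%R%:R.
  by rewrite /itv_ind ler_distl.
have e1 : (c + h = t)%R.
  have [l|g|//] := ltgtP (c + h)%R t; exfalso.
  - apply: (contra (Num.max (c + h) (- t))%R t); first by rewrite gt_max l; lra.
    move=> x /andP[]; rewrite gt_max => /andP[x1 x2] x3.
    split; first by rewrite lt_eqF// ltr_norml x2.
    rewrite !inbE sub0r add0r (ltW x2) (ltW x3) /= (leNgt x) x1 andbF.
    by rewrite eq_sym oner_eq0.
  - apply: (contra (Num.max t (c - h))%R (c + h)%R); first by rewrite gt_max g; lra.
    move=> x /andP[]; rewrite gt_max => /andP[x1 x2] x3.
    split; first by rewrite gt_eqF// (lt_le_trans x1)// ler_norm.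
    by rewrite !inbE sub0r add0r (ltW x2) (ltW x3) /= (leNgt x) x1 andbF oner_eq0.
have e2 : (c - h = - t)%R.
  have [l|g|//] := ltgtP (c - h)%R (- t)%R; exfalso.
  - apply: (contra (c - h)%R (Num.min (- t) (c + h))%R); first by rewrite lt_min l; lra.
    move=> x /andP[] x1; rewrite lt_min => /andP[x2 x3].
    split; first by rewrite gt_eqF// ltr_normr; apply/orP; right; lra.
    by rewrite !inbE sub0r add0r (ltW x1) (ltW x3) /= (leNgt (- t)%R) x2 oner_eq0.
  - apply: (contra (- t)%R (Num.min t (c - h))%R); first by rewrite lt_min g; lra.
    move=> x /andP[] x1; rewrite lt_min => /andP[x2 x3].
    split; first by rewrite lt_eqF// ltr_norml x1.
    rewrite !inbE sub0r add0r (ltW x1) (ltW x2) /= (leNgt (c - h)%R) x3 /=.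
    by rewrite eq_sym oner_eq0.
by split; lra.
Qed.

End bathtub.

(** * Integration against a flat prior *)

(** Translating the statistic tau by a uniform u on the whole line turns the
    ratio x = (tau + u) / z, for fixed data y, into a Lebesgue variable with
    Jacobian z.  D is the window of ratios outside which the two quantities
    compared coincide. *)
Section flat_prior.
Local Open Scope ereal_scope.
Context {d : measure_display} {T : measurableType d} {R : realType}.
Variables (mu : probability T R) (tau z : T -> R).
Notation leb := (@lebesgue_measure R).
Hypotheses (mtau : measurable_fun setT tau) (mz : measurable_fun setT z).
Hypothesis z0 : forall y, (0 <= z y)%R.

Let x_of (u : R) (y : T) : R := ((tau y + u) / z y)%R.

Let mx_of : measurable_fun setT (fun p : T * R => x_of p.2 p.1).
Proof.
apply: measurable_fun_div; last exact: measurableT_comp.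
by apply: measurable_funD => //; exact: measurableT_comp.
Qed.

Variable D : set R.
Hypothesis mD : measurable D.

(* Indicator of the region where the comparison is not trivial. *)
Let L (u : R) (y : T) : R := ((0 < z y)%R && (x_of u y \in D))%:R.

Let mindD : measurable_fun setT (fun x : R => x \in D).
Proof.
apply: (measurable_fun_bool true); rewrite setTI.
rewrite (_ : _ @^-1` _ = D)//; apply/seteqP; split=> x /=.
  by move/set_mem.
exact: mem_set.
Qed.

Let mL : measurable_fun setT (fun p : T * R => L p.2 p.1).
Proof.
apply: measurable_fun_bool_indicator; apply: measurable_and.
  apply: measurable_fun_ltr => //; exact: measurableT_comp.
exact: (measurableT_comp mindD mx_of).
Qed.

Let L0 u y : (0 <= L u y)%R. Proof. exact: ler0n. Qed.

Section change.
Variable F : T * R -> \bar R.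
Hypotheses (mF : measurable_fun setT F) (F0 : forall p, 0 <= F p).

Let mFx : measurable_fun setT (fun p : T * R => F (p.1, x_of p.2 p.1)).
Proof.
apply: measurableT_comp => //.
exact: measurable_fun_pair.
Qed.

Lemma integral_flat_prior :
  \int[leb]_u \int[mu]_y (F (y, x_of u y) * (L u y)%:E) =
  \int[leb]_(x in D) \int[mu]_y ((z y)%:E * F (y, x)).
Proof.
rewrite -(fubini_tonelli (m2 := leb)
  (fun p : T * R => F (p.1, x_of p.2 p.1) * (L p.2 p.1)%:E))/=; last 2 first.
- by apply: emeasurable_funM => //; exact/measurable_EFinP.
- by move=> p; rewrite mule_ge0// lee_fin.
have mH : measurable_fun setT (fun p : T * R => F p * (\1_D p.2)%:E).
  apply: emeasurable_funM => //; apply/measurable_EFinP.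
  by apply: measurableT_comp => //; exact: measurable_indic.
have mzH : measurable_fun setT (fun p : T * R => (z p.1)%:E * (F p * (\1_D p.2)%:E)).
  apply: emeasurable_funM => //; apply/measurable_EFinP.
  exact: measurableT_comp.
transitivity (\int[mu]_y \int[leb]_x ((z y)%:E * (F (y, x) * (\1_D x)%:E))).
  apply: eq_integral => y _.
  rewrite ge0_integralZl//; last 3 first.
  - exact: measurableT_comp mH (measurable_pair1 _).
  - by move=> x _; rewrite mule_ge0// lee_fin.
  - by rewrite lee_fin.
  have [zy|zy] := ltP 0%R (z y); last first.
    have -> : z y = 0%R by apply/eqP; rewrite eq_le zy z0.
    rewrite mul0e; apply: integral0_eq => u _.
    by rewrite /L (ltNge 0%R) zy/= mule0.
  pose H x := F (y, x) * (\1_D x)%:E.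
  have mHy : measurable_fun setT H.
    exact: measurableT_comp mH (measurable_pair1 _).
  have H0 x : 0 <= H x by rewrite mule_ge0// lee_fin.
  have zi : (0 < (z y)^-1)%R by rewrite invr_gt0.
  rewrite -(ge0_integral_affine (tau y / z y)%R zi mHy H0) muleA -EFinM.
  rewrite divff ?gt_eqF// mul1e; apply: eq_integral => u _.
  rewrite /H /L zy /= (_ : x_of u y = ((z y)^-1 * u + tau y / z y)%R).
    by rewrite indicE.
  by rewrite /x_of mulrDl addrC (mulrC _ u).
rewrite (fubini_tonelli (m2 := leb)
  (fun p : T * R => (z p.1)%:E * (F p * (\1_D p.2)%:E)))//; last first.
  by move=> p; rewrite mule_ge0 ?lee_fin// mule_ge0// lee_fin.
rewrite [RHS]integral_mkcond; apply: eq_integral => x _.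
rewrite epatch_indic /= -ge0_integralZr//.
- by apply: eq_integral => y _; rewrite muleA.
- apply: emeasurable_funM; first exact/measurable_EFinP.
  exact: measurableT_comp mF (measurable_pair2 _).
- by move=> y _; rewrite mule_ge0// lee_fin.
Qed.

Lemma measurable_flat_prior :
  measurable_fun setT (fun x => \int[mu]_y ((z y)%:E * F (y, x))).
Proof.
apply: (measurable_fun_fubini_tonelli_G (fun p : T * R => (z p.1)%:E * F p)).
  apply: emeasurable_funM => //; apply/measurable_EFinP; exact: measurableT_comp.
by move=> p; rewrite mule_ge0// lee_fin.
Qed.

Lemma measurable_flat_section u : measurable_fun setT (fun y => F (y, x_of u y)).
Proof. exact: measurableT_comp mFx (measurable_pair2 u). Qed.

Lemma measurable_flat_outer :
  measurable_fun setT (fun u => \int[mu]_y (F (y, x_of u y) * (L u y)%:E)).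
Proof.
apply: (measurable_fun_fubini_tonelli_G (fun p : T * R => F (p.1, x_of p.2 p.1) * (L p.2 p.1)%:E)).
  apply: emeasurable_funM => //; exact/measurable_EFinP.
by move=> p; rewrite mule_ge0// lee_fin.
Qed.

End change.

(** Outside the window F and G agree, so their common finite contribution can be
    subtracted from the inequality for each u; what is left is integrated over
    u. *)
Lemma flat_prior_le (F G : T * R -> \bar R) :
  measurable_fun setT F -> (forall p, 0 <= F p) ->
  measurable_fun setT G -> (forall p, 0 <= G p) ->
  (forall y x, (z y = 0%R) \/ ~ D x -> F (y, x) = G (y, x)) ->
  (forall u, \int[mu]_y F (y, x_of u y) < +oo) ->
  (forall u, \int[mu]_y F (y, x_of u y) <= \int[mu]_y G (y, x_of u y)) ->
  \int[leb]_(x in D) \int[mu]_y ((z y)%:E * F (y, x)) <=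
  \int[leb]_(x in D) \int[mu]_y ((z y)%:E * G (y, x)).
Proof.
move=> mF F0 mG G0 FG Foo leFG.
rewrite -!integral_flat_prior//.
apply: ge0_le_integral => //.
- by move=> u _; apply: integral_ge0 => y _; rewrite mule_ge0// lee_fin.
- exact: measurable_flat_outer.
- exact: measurable_flat_outer.
move=> u _.
have mLu : measurable_fun setT (fun y => (L u y)%:E).
  by apply/measurable_EFinP; exact: (measurableT_comp mL (measurable_pair2 u)).
have mLu' : measurable_fun setT (fun y => (1 - L u y)%:E).
  by apply/measurable_EFinP; apply: measurable_funB => //; exact/measurable_EFinP.
have L1 y : (0 <= 1 - L u y)%R by rewrite subr_ge0 /L lern1 leq_b1.
have split H : measurable_fun setT H -> (forall p, 0 <= H p) ->
    \int[mu]_y H (y, x_of u y) =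
    \int[mu]_y (H (y, x_of u y) * (L u y)%:E) +
    \int[mu]_y (H (y, x_of u y) * (1 - L u y)%:E).
  move=> mH H0; rewrite -ge0_integralD//.
  - apply: eq_integral => y _; rewrite -ge0_muleDr ?lee_fin//.
    by rewrite -EFinD addrC subrK mule1.
  - by move=> y _; rewrite mule_ge0// lee_fin.
  - by apply: emeasurable_funM => //; exact: measurable_flat_section.
  - by move=> y _; rewrite mule_ge0// lee_fin.
  - by apply: emeasurable_funM => //; exact: measurable_flat_section.
have Eout : \int[mu]_y (G (y, x_of u y) * (1 - L u y)%:E) =
            \int[mu]_y (F (y, x_of u y) * (1 - L u y)%:E).
  apply: eq_integral => y _; rewrite /L.
  have [zy|zy] := ltP 0%R (z y); last first.
    by rewrite FG//; left; apply/eqP; rewrite eq_le zy z0.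
  have [xD|xD] := boolP (x_of u y \in D); first by rewrite subrr !mule0.
  by rewrite FG//; right; move/mem_set; exact/negP.
have := leFG u; rewrite (split F)// (split G)// Eout leeD2rE//.
rewrite ge0_fin_numE; last first.
  by apply: integral_ge0 => y _; rewrite mule_ge0// lee_fin.
apply: le_lt_trans (Foo u); rewrite [leRHS](split F)//.
by apply: leeDr; apply: integral_ge0 => y _; rewrite mule_ge0// lee_fin.
Qed.

End flat_prior.

(** * Rigidity of the competing interval *)

Lemma probability_ae_witness (d : measure_display) (T : measurableType d)
    (R : realType) (mu : probability T R) (P : T -> Prop) :
  {ae mu, forall y, P y} -> exists y, P y.
Proof.
move=> [N [mN N0 PN]]; apply: contrapT => nex.
have NT : N = setT.
  by apply/seteqP; split => // y _; apply: PN => /= Py; apply: nex; exists y.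
have := probability_setT mu; rewrite -NT N0 => /eqP.
by rewrite eqe eq_sym oner_eq0.
Qed.

Lemma measurable_gauss_mass (d : measure_display) (T : measurableType d)
    (R : realType) (c h : T -> R) :
  measurable_fun setT c -> measurable_fun setT h ->
  measurable_fun setT (fun y => gauss_mass (c y) (h y)).
Proof.
move=> mc mh.
apply: (measurable_fun_fubini_tonelli_F (m2 := @lebesgue_measure R)
  (fun p : T * R => (itv_ind (c p.1) (h p.1) p.2 * phi p.2)%:E)).
  apply/measurable_EFinP/measurable_funM.
    by apply: measurable_itv_ind => //; exact: measurableT_comp.
  by apply: measurableT_comp => //; exact: measurable_phi.
by move=> p; rewrite lee_fin mulr_ge0 ?itv_ind_ge0 ?phi_ge0.
Qed.

(** The comparison reduced to a standard Gaussian vector y.  The error of the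
    center is <q, y> with q a unit vector, S is the residual standard deviation,
    which does not change along q, w is the scale of the half-widths and z that
    of the statistic tau + u. *)
Section core.
Local Open Scope ereal_scope.
Context {R : realType} {n : nat} (mu : probability 'cV[R]_n R).
Hypothesis muN : std_gaussian mu.
Notation leb := (@lebesgue_measure R).
Variables (q : 'cV[R]_n) (S tau : 'cV[R]_n -> R).
Hypotheses (q1 : dotv q q = 1%R) (mS : measurable_fun setT S)
  (mtau : measurable_fun setT tau) (S0 : forall y, (0 <= S y)%R)
  (Sq : forall y l, S (y + l *: q)%R = S y)
  (Spos : {ae mu, forall y, (0 < S y)%R})
  (S2 : \int[mu]_y (S y ^+ 2)%:E < +oo).
Variables (k1 k2 tm d : R) (b s : R -> R).
Hypotheses (k10 : (0 < k1)%R) (k20 : (0 < k2)%R) (tm0 : (0 < tm)%R) (d0 : (0 < d)%R).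
Hypotheses (mb : measurable_fun setT b) (ms : measurable_fun setT s)
  (s0 : forall x, (0 < s x)%R)
  (out : forall x, (d <= `|x|)%R -> b x = 0%R /\ s x = tm).

Let w y := (k1 * S y)%R.
Let z y := (S y * k2)%R.
Let D := `](- d)%R, d[%classic.

Hypothesis len_le : forall u,
  \int[mu]_y (w y * s ((tau y + u) / z y))%:E <= \int[mu]_y (w y * tm)%:E.
Hypothesis cov_le : forall u,
  \int[mu]_y (itv_ind 0 (w y * tm) (dotv q y))%:E <=
  \int[mu]_y (itv_ind (w y * b ((tau y + u) / z y)) (w y * s ((tau y + u) / z y))
                  (dotv q y))%:E.

Let w0 y : (0 <= w y)%R. Proof. by rewrite mulr_ge0// ltW. Qed.
Let z0 y : (0 <= z y)%R. Proof. by rewrite mulr_ge0// ltW. Qed.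
Let mw : measurable_fun setT w. Proof. exact: measurable_funM. Qed.
Let mz : measurable_fun setT z. Proof. exact: measurable_funM. Qed.
Let mD : measurable D. Proof. exact: measurable_itv. Qed.
Let lebD : leb D = (2 * d)%:E.
Proof.
have dd : (- d < d)%R by move: d0; lra.
rewrite lebesgue_measure_itv/= lte_fin dd.
by rewrite -EFinB; congr EFin; ring.
Qed.
Let s0' x : (0 <= s x)%R. Proof. exact: ltW. Qed.
Let mdot : measurable_fun setT (fun y : 'cV[R]_n => dotv q y).
Proof. by apply: measurable_dotv => //; exact: measurable_cst. Qed.

Let notD x : ~ D x -> (d <= `|x|)%R.
Proof.
move=> nDx; rewrite leNgt; apply/negP => xd; apply: nDx.
by rewrite /D/= in_itv/= -ltr_norml.
Qed.

Let zw0 y : z y = 0%R -> w y = 0%R.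
Proof. by move/eqP; rewrite mulf_eq0 (gt_eqF k20) orbF /w => /eqP ->; rewrite mulr0. Qed.

Let bounded_by_S2 (f : 'cV[R]_n -> R) (C : R) :
  measurable_fun setT f -> (forall y, 0 <= f y)%R -> (forall y, f y <= C * (1 + S y ^+ 2))%R ->
  (0 <= C)%R -> exists2 r, (0 <= r)%R & \int[mu]_y (f y)%:E = r%:E.
Proof.
move=> mf f0 fC C0.
have i0 : 0 <= \int[mu]_y (f y)%:E by apply: integral_ge0 => y _; rewrite lee_fin.
have ioo : \int[mu]_y (f y)%:E < +oo.
  have mS2 : measurable_fun setT (fun y => (S y ^+ 2)%:E).
    by apply/measurable_EFinP; exact: measurable_funX.
  apply: (@le_lt_trans _ _ (\int[mu]_y (C%:E * (1 + (S y ^+ 2)%:E)))).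
    apply: ge0_le_integral => //.
    - by move=> y _; rewrite lee_fin.
    - exact/measurable_EFinP.
    - by apply: emeasurable_funM => //; exact: emeasurable_funD.
    - by move=> y _; rewrite -EFinD -EFinM lee_fin.
  rewrite ge0_integralZl//; last 2 first.
  - exact: emeasurable_funD.
  - by move=> y _; rewrite -EFinD lee_fin addr_ge0// sqr_ge0.
  rewrite ge0_integralD//; last by move=> y _; rewrite lee_fin sqr_ge0.
  rewrite lte_mul_pinfty//; rewrite integral_cst//= mul1e.
  apply: lte_add_pinfty => //.
  by apply: le_lt_trans (probability_le1 mu measurableT) _; exact: ltry.
exists (fine (\int[mu]_y (f y)%:E)); first exact: fine_ge0.
by rewrite fineK// ge0_fin_numE.
Qed.

Let S_le y : (S y <= 1 * (1 + S y ^+ 2))%R.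
Proof. by rewrite mul1r; have := sqr_ge0 (S y - 1); have := S0 y; nra. Qed.

(* Here the integrand factors as z w times s x, so the positive finite constant
   E[z w] cancels. *)
Let len_integrated : \int[leb]_(x in D) (s x)%:E <= (tm * (2 * d))%:E.
Proof.
have [W W0 WE] : exists2 r, (0 <= r)%R & \int[mu]_y (z y * w y)%:E = r%:E.
  apply: (@bounded_by_S2 _ (k1 * k2)) => //.
  - exact: measurable_funM.
  - by move=> y; rewrite mulr_ge0.
  - move=> y; rewrite (_ : (z y * w y = k1 * k2 * S y ^+ 2)%R); last by rewrite /z /w; ring.
    by rewrite ler_pM2l ?mulr_gt0// lerDr.
  - by rewrite mulr_ge0// ltW.
have {}W0 : (0 < W)%R.
  rewrite lt_neqAle W0 andbT eq_sym; apply/eqP => We0.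
  have mzw : measurable_fun setT (fun y => (z y * w y)%:E).
    by apply/measurable_EFinP; exact: measurable_funM.
  have : \int[mu]_y `|(z y * w y)%:E| = 0.
    transitivity W%:E; last by rewrite We0.
    rewrite -WE; apply: eq_integral => y _.
    by rewrite gee0_abs// lee_fin mulr_ge0.
  move/(ae_eq_integral_abs mu measurableT mzw) => ae0.
  have [y [Sy /(_ I)]] : exists y, (0 < S y)%R /\ (setT y -> (z y * w y)%:E = 0).
    by apply: (@probability_ae_witness _ _ _ mu); exact: filterS2 Spos ae0.
  by move=> [] /eqP; rewrite gt_eqF// mulr_gt0// mulr_gt0.
have := @flat_prior_le _ _ _ mu tau z mtau mz z0 D mD
  (fun p => (w p.1 * s p.2)%:E) (fun p => (w p.1 * tm)%:E).
have mzwE : measurable_fun setT (fun y => (z y * w y)%:E).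
  by apply/measurable_EFinP; exact: measurable_funM.
have inner (a : R) : (0 <= a)%R -> \int[mu]_y ((z y)%:E * (w y * a)%:E) = a%:E * W%:E.
  move=> a0; rewrite -WE -ge0_integralZl//.
  - by apply: eq_integral => y _; rewrite -!EFinM; congr EFin; ring.
  - by move=> y _; rewrite lee_fin mulr_ge0.
move=> h.
have {h} : \int[leb]_(x in D) ((s x)%:E * W%:E) <= \int[leb]_(x in D) (tm%:E * W%:E).
  under eq_integral do rewrite -inner//.
  under [leRHS]eq_integral do rewrite -inner ?ltW//.
  apply: h.
  - apply/measurable_EFinP/measurable_funM; exact: measurableT_comp.
  - by move=> p; rewrite lee_fin mulr_ge0.
  - apply/measurable_EFinP/measurable_funM => //; exact: measurableT_comp.
  - by move=> p; rewrite lee_fin mulr_ge0// ltW.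
  - move=> y x /=; case=> [/zw0 ->|/notD/out[_ ->]//].
    by rewrite !mul0r.
  - move=> u /=; apply: le_lt_trans (len_le u) _.
    have [r _ ->] : exists2 r, (0 <= r)%R & \int[mu]_y (w y * tm)%:E = r%:E.
      apply: (@bounded_by_S2 _ (k1 * tm)%R).
      + exact: measurable_funM.
      + by move=> y; rewrite mulr_ge0// ltW.
      + move=> y; rewrite /w mulrAC ler_pM2l ?mulr_gt0//.
        by have := S_le y; rewrite mul1r.
      + by rewrite mulr_ge0// ltW.
    by rewrite ltry.
  - by move=> u /=; exact: len_le.
rewrite ge0_integralZr//; last 3 first.
- by apply/measurable_EFinP; exact: measurable_funTS.
- by move=> x _; rewrite lee_fin.
- by rewrite lee_fin ltW.
rewrite integral_cst// [X in _ <= _ * X](_ : _ = (2 * d)%:E); last exact: lebD.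
rewrite -EFinM => h.
have {h} : (\int[leb]_(x in D) (s x)%:E) * W%:E <= (tm * (2 * d))%:E * W%:E.
  apply: (le_trans h); rewrite -EFinM lee_fin le_eqVlt; apply/orP; left.
  by apply/eqP; ring.
by rewrite lee_pmul2r.
Qed.

Let ev (beta t : R) (y : 'cV[R]_n) : R := itv_ind (w y * beta) (w y * t) (dotv q y).

Let mev beta t : measurable_fun setT (ev beta t).
Proof. by apply: measurable_itv_ind => //; exact: measurable_funM. Qed.

(* Coverage weighted by the Jacobian z, for center w beta and half-width w t. *)
Let cE beta t := \int[mu]_y ((z y)%:E * (ev beta t y)%:E).

(* Neither w nor z changes along q, so resampling that direction replaces the
   event by its normal mass given S. *)
Let cE_resample beta t :
  cE beta t = \int[mu]_y ((z y)%:E * gauss_mass (w y * beta) (w y * t)).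
Proof.
rewrite /cE (std_gaussian_resample muN q1); last 2 first.
- by apply: emeasurable_funM; apply/measurable_EFinP => //; exact: mev.
- by move=> y; rewrite mule_ge0 ?lee_fin// itv_ind_ge0.
apply: eq_integral => y _; rewrite /gauss_mass -ge0_integralZl//.
- apply: eq_integral => l _.
  have wq : w (y + (l - dotv q y) *: q)%R = w y by rewrite /w Sq.
  have -> : z (y + (l - dotv q y) *: q)%R = z y by rewrite /z Sq.
  rewrite /ev wq dotvDr dotvZr q1 mulr1 addrC subrK.
  by rewrite -muleA -EFinM.
- apply/measurable_EFinP/measurable_funM; last exact: measurable_phi.
  exact: measurable_itv_ind.
- by move=> l _; rewrite lee_fin mulr_ge0 ?itv_ind_ge0 ?phi_ge0.
- by rewrite lee_fin.
Qed.

Let cE_bound : exists2 Z, (0 <= Z)%R & forall beta t, cE beta t <= Z%:E.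
Proof.
have [Z Z0 ZE] : exists2 r, (0 <= r)%R & \int[mu]_y (z y)%:E = r%:E.
  apply: (@bounded_by_S2 _ k2) => //; last exact: ltW.
  move=> y; rewrite /z mulrC ler_pM2l//.
  by have := S_le y; rewrite mul1r.
exists Z => // beta t; rewrite -ZE; apply: ge0_le_integral => //.
- by move=> y _; rewrite mule_ge0 ?lee_fin// itv_ind_ge0.
- by apply: emeasurable_funM; apply/measurable_EFinP => //; exact: mev.
- exact/measurable_EFinP.
- move=> y _; rewrite -EFinM lee_fin ler_piMr//.
  by rewrite /ev /itv_ind lern1 leq_b1.
Qed.

(* The marginal value of half-width: z times the derivative of the normal mass
   of [-w t, w t] at t = tm.  It is the Lagrange multiplier of the problem,
   before averaging over y. *)
Let kap y := (z y * (phi (w y * tm) * (2 * w y)))%R.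

Let kap0 y : (0 <= kap y)%R.
Proof. by rewrite mulr_ge0// mulr_ge0 ?phi_ge0// mulr_ge0. Qed.

Let mkap : measurable_fun setT kap.
Proof.
apply: measurable_funM => //; apply: measurable_funM; last exact: measurable_funM.
by apply: measurableT_comp; [exact: measurable_phi|exact: measurable_funM].
Qed.

Let kapE : exists2 K, (0 <= K)%R & \int[mu]_y (kap y)%:E = K%:E.
Proof.
apply: (@bounded_by_S2 _ (k1 * k2 * 2 * phi 0)) => //.
  move=> y; rewrite (_ : kap y = (k1 * k2 * 2 * phi (w y * tm)) * S y ^+ 2)%R.
    apply: ler_pM; rewrite ?sqr_ge0// ?lerDr//.
      by rewrite !mulr_ge0 ?phi_ge0// ltW.
    by rewrite ler_pM2l ?mulr_gt0// phi_le// normr0.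
  by rewrite /kap /z /w; ring.
by rewrite !mulr_ge0 ?phi_ge0// ltW.
Qed.

Let side (beta t t' : R) (y : 'cV[R]_n) :=
  (z y)%:E * (gauss_mass (w y * beta) (w y * t) +
              (phi (w y * tm) * (2 * (w y * t')))%:E).

Let side_ge0 beta t t' y : (0 <= t')%R -> 0 <= side beta t t' y.
Proof.
move=> t'0; rewrite mule_ge0 ?lee_fin// adde_ge0 ?gauss_mass_ge0// lee_fin.
by rewrite mulr_ge0 ?phi_ge0// mulr_ge0// mulr_ge0.
Qed.

Let mgm beta t : measurable_fun setT (fun y => gauss_mass (w y * beta) (w y * t)).
Proof. by apply: measurable_gauss_mass; exact: measurable_funM. Qed.

Let mside beta t t' : measurable_fun setT (side beta t t').
Proof.
apply: emeasurable_funM; first exact/measurable_EFinP.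
apply: emeasurable_funD; first exact: mgm.
apply/measurable_EFinP/measurable_funM.
  by apply: measurableT_comp; [exact: measurable_phi|exact: measurable_funM].
by apply: measurable_funM => //; exact: measurable_funM.
Qed.

Let integral_side K beta t t' : \int[mu]_y (kap y)%:E = K%:E -> (0 <= t')%R ->
  \int[mu]_y side beta t t' y = cE beta t + (K * t')%:E.
Proof.
move=> KE t'0; rewrite cE_resample EFinM -KE.
rewrite -(@ge0_integralZr _ _ _ mu setT measurableT (fun y => (kap y)%:E)); last 3 first.
- exact/measurable_EFinP.
- by move=> y _; rewrite lee_fin.
- by rewrite lee_fin.
rewrite -ge0_integralD//.
- apply: eq_integral => y _; rewrite /side ge0_muleDr ?gauss_mass_ge0//.
    by congr (_ + _); rewrite -!EFinM; congr EFin; rewrite /kap; ring.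
  by rewrite lee_fin mulr_ge0 ?phi_ge0// mulr_ge0// mulr_ge0.
- by move=> y _; rewrite mule_ge0 ?lee_fin ?gauss_mass_ge0.
- by apply: emeasurable_funM; [exact/measurable_EFinP|exact: mgm].
- by move=> y _; rewrite -EFinM lee_fin mulr_ge0.
- by apply: emeasurable_funM => //; exact/measurable_EFinP.
Qed.

Let side_le beta t y : (0 < t)%R -> side beta t tm y <= side 0 tm t y.
Proof.
move=> t0; rewrite /side mulr0; apply: lee_wpmul2l; first by rewrite lee_fin.
by apply: bathtub; rewrite mulr_ge0// ltW.
Qed.

Let side_eq beta t y : (0 < t)%R -> (0 < S y)%R ->
  side 0 tm t y <= side beta t tm y -> beta = 0%R /\ t = tm.
Proof.
move=> t0 Sy; have wy : (0 < w y)%R by rewrite mulr_gt0.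
rewrite /side mulr0 lee_pmul2l//; last by rewrite lte_fin mulr_gt0.
move=> /bathtub_eq[]; rewrite ?mulr_gt0// => e1 e2; split.
  by apply/eqP; move/eqP: e1; rewrite mulf_eq0 (gt_eqF wy).
by apply: (mulfI _ e2); rewrite gt_eqF.
Qed.

Let cov_integrated : \int[leb]_(x in D) cE 0 tm <= \int[leb]_(x in D) cE (b x) (s x).
Proof.
apply: (@flat_prior_le _ _ _ mu tau z mtau mz z0 D mD
  (fun p => (ev 0 tm p.1)%:E) (fun p => (ev (b p.2) (s p.2) p.1)%:E)).
- by apply/measurable_EFinP; apply: measurableT_comp => //; exact: mev.
- by move=> p; rewrite lee_fin itv_ind_ge0.
- apply/measurable_EFinP; apply: measurable_itv_ind.
  + apply: measurable_funM; exact: measurableT_comp.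
  + apply: measurable_funM; exact: measurableT_comp.
  + exact: measurableT_comp.
- by move=> p; rewrite lee_fin itv_ind_ge0.
- move=> y x /=; case=> [/zw0 wy|/notD/out[-> ->]//].
  by rewrite /ev wy !mul0r.
- move=> u /=; apply: (@le_lt_trans _ _ (\int[mu]_y (cst 1 y))).
    apply: ge0_le_integral => //.
    + by move=> y _; rewrite lee_fin itv_ind_ge0.
    + by apply/measurable_EFinP; exact: mev.
    + by move=> y _; rewrite lee_fin /ev /itv_ind lern1 leq_b1.
  rewrite integral_cst//= mul1e.
  by apply: le_lt_trans (probability_le1 mu measurableT) _; exact: ltry.
- move=> u /=; under eq_integral do rewrite /ev mulr0.
  exact: cov_le.
Qed.

(** For each x, coverage + K tm <= usual coverage + K s(x), by the bathtub
    inequality averaged over y, where K is the mean of the multiplier.  The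
    integrated hypotheses give the reverse inequality for the integrals over D,
    so the two sides agree for almost every x; for such x they agree for some y
    with S y > 0, and there the bathtub inequality is an equality. *)
Lemma interval_rigidity : {ae leb, forall x, b x = 0%R /\ s x = tm}.
Proof.
have [K K0 KE] := kapE.
have [Z Z0 cEZ] := cE_bound.
have cE0 beta t : 0 <= cE beta t.
  by apply: integral_ge0 => y _; rewrite mule_ge0 ?lee_fin// itv_ind_ge0.
have mcE : measurable_fun setT (fun x => cE (b x) (s x)).
  apply: (@measurable_flat_prior _ _ _ mu z mz z0 (fun p => (ev (b p.2) (s p.2) p.1)%:E)).
    apply/measurable_EFinP; apply: measurable_itv_ind.
    + apply: measurable_funM; exact: measurableT_comp.
    + apply: measurable_funM; exact: measurableT_comp.
    + exact: measurableT_comp.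
  by move=> p; rewrite lee_fin itv_ind_ge0.
pose Hl x := cE (b x) (s x) + (K * tm)%:E.
pose Hr x := cE 0 tm + (K * s x)%:E.
have mKs : measurable_fun setT (fun x => (K * s x)%:E).
  by apply/measurable_EFinP; exact: measurable_funM.
have splitD (f : R -> \bar R) (g : R -> R) : measurable_fun setT f ->
    (forall x, 0 <= f x) -> measurable_fun setT g -> (forall x, 0 <= g x)%R ->
    \int[leb]_(x in D) (f x + (K * g x)%:E) =
    \int[leb]_(x in D) f x + K%:E * \int[leb]_(x in D) (g x)%:E.
  move=> mf f0 mg g0; rewrite ge0_integralD//.
  - congr (_ + _); under eq_integral do rewrite EFinM.
    rewrite ge0_integralZl//; first by apply/measurable_EFinP; exact: measurable_funTS.
    by move=> x _; rewrite lee_fin.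
  - exact: measurable_funTS.
  - by move=> x _; rewrite lee_fin mulr_ge0.
  - by apply: measurable_funTS; apply/measurable_EFinP; exact: measurable_funM.
have HlHr : ae_eq leb D Hl Hr.
  apply: ge0_le_integral_ae_eq => //.
  - by apply: measurable_funTS; apply: emeasurable_funD.
  - by apply: measurable_funTS; apply: emeasurable_funD.
  - by move=> x _; rewrite adde_ge0// lee_fin mulr_ge0// ltW.
  - move=> x _; rewrite /Hl /Hr -(integral_side _ _ KE (ltW tm0)) -(integral_side _ _ KE (s0' x)).
    apply: ge0_le_integral => //.
    + by move=> y _; exact/side_ge0/ltW.
    + by move=> y _; exact: side_le.
  - rewrite [leLHS](splitD (fun=> cE 0 tm) s)// [leRHS](splitD _ (fun=> tm))//.
    + apply: leeD; first exact: cov_integrated.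
      apply: lee_wpmul2l; first by rewrite lee_fin.
      rewrite [leRHS]integral_cst// [X in _ <= _ * X](_ : _ = (2 * d)%:E); last exact: lebD.
      by rewrite -EFinM.
    + by move=> x; exact: ltW.
  - apply: (@le_lt_trans _ _ (\int[leb]_(x in D) (Z + K * tm)%:E)).
      apply: ge0_le_integral => //.
      + by move=> x _; rewrite adde_ge0// lee_fin mulr_ge0// ltW.
      + by apply: measurable_funTS; apply: emeasurable_funD.
      + by move=> x _; rewrite EFinD leeD2r.
    rewrite integral_cst// [X in _ * X](_ : _ = (2 * d)%:E); last exact: lebD.
    by rewrite -EFinM ltry.
apply: filterS HlHr => x Hx.
have [xD|/notD/out//] := pselect (D x).
have Hlr := Hx xD.
have sides : ae_eq mu setT (side (b x) (s x) tm) (side 0 tm (s x)).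
  apply: ge0_le_integral_ae_eq => //.
  - by move=> y _; exact/side_ge0/ltW.
  - by move=> y _; exact: side_le.
  - rewrite (integral_side _ _ KE (ltW tm0)) (integral_side _ _ KE (s0' x)).
    by move: Hlr; rewrite /Hl /Hr => ->.
  - rewrite (integral_side _ _ KE)//; last exact: ltW.
    by apply: lte_add_pinfty; [apply: le_lt_trans (cEZ _ _) _; exact: ltry|exact: ltry].
have [y [Sy /(_ I) e]] : exists y, (0 < S y)%R /\
    (setT y -> side (b x) (s x) tm y = side 0 tm (s x) y).
  by apply: (@probability_ae_witness _ _ _ mu); exact: filterS2 Spos sides.
by apply: (@side_eq (b x) (s x) y) => //; rewrite e.
Qed.

End core.

(** * The law of the response *)

Section image_probability.
Local Open Scope ereal_scope.
Context {d1 d2 : measure_display} {T1 : measurableType d1}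
  {T2 : measurableType d2} {R : realType}.
Variables (P : probability T1 R) (phi : T1 -> T2).
Hypothesis mphi : measurable_fun setT phi.

Definition image_prob : set T2 -> \bar R :=
  image_measure P mphi.

Local Notation nu := image_prob.

Let nu0 : nu set0 = 0. Proof. exact: measure0. Qed.
Let nu_ge0 A : 0 <= nu A. Proof. exact: measure_ge0. Qed.
Let nu_sigma : semi_sigma_additive nu.
Proof. exact: measure_semi_sigma_additive. Qed.

HB.instance Definition _ := isMeasure.Build _ _ _ nu nu0 nu_ge0 nu_sigma.

Let nuT : nu setT = 1.
Proof. by rewrite /image_prob /= /pushforward preimage_setT probability_setT. Qed.

HB.instance Definition _ := Measure_isProbability.Build _ _ _ nu nuT.

End image_probability.

Section normal_scaling.
Local Open Scope ereal_scope.
Context {R : realType}.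
Notation leb := (@lebesgue_measure R).
Notation gauss := (normal_prob (0 : R) 1).

Lemma normal_pdf_scale (s x : R) : (0 < s)%R ->
  normal_pdf 0 s x = (s^-1 * phi (s^-1 * x))%R.
Proof.
move=> s0; have sn : s != 0%R by rewrite gt_eqF.
rewrite phiE normal_pdfE// /normal_fun subr0 mulrA; congr (_ * expR _)%R.
  rewrite /normal_peak expr1n mul1r -mulrnAr sqrtrM ?sqr_ge0//.
  by rewrite sqrtr_sqr gtr0_norm// invfM.
by rewrite exprMn -mulr_natr; field.
Qed.

Lemma normal_prob_scale (s : R) (B : set R) : (0 < s)%R -> measurable B ->
  normal_prob 0%R s ((fun x => s^-1 * x)%R @^-1` B) = gauss B.
Proof.
move=> s0 mB; have si : (0 < s^-1)%R by rewrite invr_gt0.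
rewrite /normal_prob integral_mkcond [RHS]integral_mkcond.
pose H (x : R) := (\1_B x * phi x)%:E.
have mH : measurable_fun setT H.
  apply/measurable_EFinP/measurable_funM; last exact: measurable_phi.
  exact: (measurable_indic mB).
have H0 x : 0 <= H x by rewrite lee_fin mulr_ge0 ?phi_ge0.
transitivity (\int[leb]_x H x); last first.
  by apply: eq_integral => x _; rewrite epatch_indic /H /= EFinM muleC.
have mHs : measurable_fun setT (fun x => H (s^-1 * x + 0)%R).
  by apply: measurableT_comp => //; apply: measurable_funD => //; exact: measurable_funM.
have si0 : 0 <= s^-1%:E by rewrite lee_fin ltW.
rewrite -(ge0_integral_affine 0%R si mH H0) -ge0_integralZl//.
apply: eq_integral => x _; rewrite epatch_indic /H /= addr0 -!EFinM; congr EFin.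
have -> : \1_((fun x => s^-1 * x)%R @^-1` B) x = \1_B (s^-1 * x)%R :> R.
  by rewrite !indicE.
by rewrite normal_pdf_scale//; ring.
Qed.

(** The preimage of a null set under a nonconstant affine map is null, and phi is
    bounded. *)
Lemma integral_phi_null (N : set R) (k c : R) : measurable N -> leb N = 0 ->
  (0 < k)%R -> \int[leb]_x (\1_N (k * x + c)%R * phi x)%:E = 0.
Proof.
move=> mN N0 k0.
have mi : measurable_fun setT (fun x => \1_N (k * x + c)%R : R).
  apply: measurableT_comp; first exact: (measurable_indic mN).
  by apply: measurable_funD => //; exact: measurable_funM.
apply/eqP; rewrite eq_le; apply/andP; split; last first.
  by apply: integral_ge0 => x _; rewrite lee_fin mulr_ge0 ?phi_ge0.
have mE : measurable_fun setT (fun x => (\1_N x)%:E : \bar R).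
  by apply/measurable_EFinP; exact: (measurable_indic mN).
have z : \int[leb]_x (\1_N (k * x + c)%R)%:E = 0.
  have E0 x : 0 <= (\1_N x)%:E :> \bar R by rewrite lee_fin.
  have : k%:E * \int[leb]_x (\1_N (k * x + c)%R)%:E = 0.
    by rewrite (ge0_integral_affine c k0 mE E0) integral_indic// setIT.
  by move/eqP; rewrite mule_eq0 eqe (gt_eqF k0) => /eqP.
have miE : measurable_fun setT (fun x => (\1_N (k * x + c)%R)%:E : \bar R).
  exact/measurable_EFinP.
have phi00 : 0 <= (phi (0 : R))%:E by rewrite lee_fin phi_ge0.
rewrite -(mule0 (phi 0)%:E) -z -ge0_integralZl//.
apply: ge0_le_integral => //.
- by move=> x _; rewrite lee_fin mulr_ge0 ?phi_ge0.
- by apply/measurable_EFinP/measurable_funM => //; exact: measurable_phi.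
- by apply/measurable_EFinP/measurable_funM.
- move=> x _; rewrite -EFinM lee_fin mulrC ler_wpM2r//.
  by rewrite phi_le// normr0.
Qed.

Let measurable_idE : measurable_fun setT (fun x : R => x%:E).
Proof. exact/measurable_EFinP. Qed.

Lemma ge0_integral_gaussN (f : R -> \bar R) :
  measurable_fun setT f -> (forall x, 0 <= f x) ->
  \int[gauss]_x f (- x)%R = \int[gauss]_x f x.
Proof.
move=> mf f0.
have mfN : measurable_fun setT (fun x : R => f (- x)%R) by exact: measurableT_comp.
rewrite !ge0_integral_std_normal//.
pose F (x : R) := f x * (phi x)%:E.
have mF : measurable_fun setT F.
  by apply: emeasurable_funM => //; apply/measurable_EFinP; exact: measurable_phi.
have F0 x : 0 <= F x by rewrite mule_ge0 ?lee_fin ?phi_ge0.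
have lebN A : measurable A -> leb A = leb ((fun x : R => - x)%R @^-1` A).
  by move=> mA; exact/esym/lebesgue_measureN.
transitivity (\int[leb]_x F (- x)%R).
  by apply: eq_integral => x _; rewrite /F phiN.
pose opp : measurableTypeR R -> measurableTypeR R := fun x => (- x)%R.
have mopp : measurable_fun setT opp by exact: oppr_measurable.
exact: (esym (@ge0_integral_image _ _ _ _ _ leb leb opp F mopp lebN mF F0)).
Qed.

Lemma integrable_gauss_id :
  (gauss : {measure set _ -> \bar R}).-integrable setT (fun x : R => x%:E).
Proof.
apply/integrableP; split => //.
apply: (@le_lt_trans _ _ (\int[gauss]_x (1 + (x ^+ 2)%:E))).
  apply: ge0_le_integral => //.
  - exact: measurableT_comp.
  - by apply: emeasurable_funD => //; apply/measurable_EFinP; exact: measurable_funX.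
  - move=> x _; rewrite -EFinD lee_fin /=.
    have := sqr_ge0 (`|x| - 1)%R; rewrite -(real_normK (num_real x)).
    by have := normr_ge0 x; nra.
rewrite ge0_integralD//; last 2 first.
- by move=> x _; rewrite lee_fin sqr_ge0.
- by apply/measurable_EFinP; exact: measurable_funX.
rewrite integral_cst//= mul1e gauss_sqrE.
apply: lte_add_pinfty; last exact: ltry.
by apply: (le_lt_trans (probability_le1 gauss measurableT)); exact: ltry.
Qed.

Lemma integral_gauss_id : \int[gauss]_x x%:E = 0.
Proof.
have fin := integrable_fin_num measurableT integrable_gauss_id.
rewrite integralE.
have -> : \int[gauss]_x (fun x : R => x%:E)^\- x = \int[gauss]_x (fun x : R => x%:E)^\+ x.
  rewrite -[LHS]ge0_integral_gaussN//; last exact: measurable_funeneg.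
  by apply: eq_integral => x _; rewrite funenegE funeposE EFinN oppeK.
have : \int[gauss]_x (fun x : R => x%:E)^\+ x \is a fin_num.
  apply: integrable_fin_num => //; apply: integrable_funepos => //.
  exact: integrable_gauss_id.
exact: subee.
Qed.

(** The mean of the standard normal law is zero by symmetry. *)
Lemma integral_gauss_affine (a k : R) : \int[gauss]_x (a + k * x)%:E = a%:E.
Proof.
under eq_integral do rewrite EFinD EFinM.
rewrite integralD//; last 2 first.
- by apply: finite_measure_integrable_cst.
- by apply: integrableZl => //; exact: integrable_gauss_id.
rewrite integralZl//; last exact: integrable_gauss_id.
rewrite integral_gauss_id mule0 adde0 integral_cst//.
by rewrite [X in _ * X](probability_setT gauss) mule1.
Qed.

End normal_scaling.

Section noise.
Local Open Scope ereal_scope.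
Context {disp : measure_display} {Omega : measurableType disp} {R : realType}
  {n p : nat}.
Variables (X : 'M[R]_(n, p)) (P : 'cV[R]_p -> R -> probability Omega R)
  (Y : Omega -> 'cV[R]_n).
Hypothesis YP : linear_regression X P Y.
Notation gauss := (normal_prob (0 : R) 1).

Lemma measurable_response : measurable_fun setT Y.
Proof.
have [mY _] := YP 0%R (@ltr01 R).
apply: measurable_fun_column => i.
apply: eq_measurable_fun (mY i) => w _.
by rewrite mulmx0 subr0.
Qed.

Definition noise (beta : 'cV[R]_p) (sigma : R) (w : Omega) : 'cV[R]_n :=
  (sigma^-1 *: (Y w - X *m beta))%R.

Lemma measurable_noise beta sigma : measurable_fun setT (noise beta sigma).
Proof.
apply: measurable_column_scale; first exact: measurable_cst.
apply: measurable_column_add; [exact: measurable_response|exact: measurable_cst].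
Qed.

Lemma noiseK beta sigma w : (0 < sigma)%R ->
  Y w = (X *m beta + sigma *: noise beta sigma w)%R.
Proof. by move=> s0; rewrite scalerA divff ?gt_eqF// scale1r addrC subrK. Qed.

Lemma noise_box beta sigma2 B : (0 < sigma2)%R -> (forall i, measurable (B i)) ->
  P beta sigma2 (noise beta (Num.sqrt sigma2) @^-1` box B) =
  \prod_(i < n) gauss (B i).
Proof.
move=> s20 mB; have [_ YB] := YP beta s20.
have s0 : (0 < Num.sqrt sigma2)%R by rewrite sqrtr_gt0.
set s := Num.sqrt sigma2 in s0 YB *.
rewrite (_ : _ @^-1` box B =
    [set w | forall i, ((fun x => s^-1 * x)%R @^-1` B i) ((Y w - X *m beta)%R i 0%R)]).
  rewrite (YB (fun i => (fun x => s^-1 * x)%R @^-1` B i)) => [|i].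
    by apply: eq_bigr => i _; rewrite normal_prob_scale.
  by rewrite -[X in measurable X]setTI; exact: measurable_funM.
by apply/seteqP; split=> w /= h i; have := h i; rewrite /noise !mxE.
Qed.

(** The law of the normalized noise at one reference parameter; by
    [noise_lawE] every parameter gives the same one. *)
Definition noise_law : probability 'cV[R]_n R :=
  image_prob (P 0%R 1%R) (measurable_noise 0%R 1%R).

Lemma noise_law_std : std_gaussian noise_law.
Proof.
by move=> B mB; have := noise_box 0%R (@ltr01 R) mB; rewrite sqrtr1.
Qed.

Lemma noise_lawE beta sigma2 A : (0 < sigma2)%R -> measurable A ->
  noise_law A = P beta sigma2 (noise beta (Num.sqrt sigma2) @^-1` A).
Proof.
move=> s0 mA.
apply: (@measure_unique_boxes _ _ noise_law
  (image_measure (P beta sigma2) (measurable_noise beta (Num.sqrt sigma2)))) => //.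
  by apply: (le_lt_trans (probability_le1 noise_law measurableT)); exact: ltry.
move=> B mB; rewrite [LHS]noise_law_std//.
by rewrite -(noise_box beta s0 mB).
Qed.

Lemma ge0_integral_response beta sigma2 (f : 'cV[R]_n -> \bar R) :
  (0 < sigma2)%R -> measurable_fun setT f -> (forall y, 0 <= f y) ->
  \int[P beta sigma2]_w f (Y w) =
  \int[noise_law]_y f (X *m beta + Num.sqrt sigma2 *: y)%R.
Proof.
move=> s0 mf f0; have ss0 : (0 < Num.sqrt sigma2)%R by rewrite sqrtr_gt0.
rewrite (@ge0_integral_image _ _ _ _ _ (P beta sigma2) noise_law
   (noise beta (Num.sqrt sigma2)) (fun y => f (X *m beta + Num.sqrt sigma2 *: y)%R))//.
- by apply: eq_integral => w _; rewrite -noiseK.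
- exact: measurable_noise.
- by move=> A mA; exact: noise_lawE.
- apply: measurableT_comp => //; apply: measurable_column_add; first exact: measurable_cst.
  by apply: measurable_column_scale => //; exact: measurable_cst.
Qed.

Lemma probability_response beta sigma2 (b : 'cV[R]_n -> bool) :
  (0 < sigma2)%R -> measurable_fun setT b ->
  P beta sigma2 [set w | b (Y w)] =
  \int[noise_law]_y ((b (X *m beta + Num.sqrt sigma2 *: y)%R)%:R : R)%:E.
Proof.
move=> s0 mb; have mbR : measurable_fun setT (fun y => ((b y)%:R : R)).
  exact: measurable_fun_bool_indicator.
have mbE : measurable_fun setT (fun y => ((b y)%:R : R)%:E) by exact/measurable_EFinP.
have bE0 y : 0 <= ((b y)%:R : R)%:E by rewrite lee_fin.
rewrite -(ge0_integral_response _ s0 mbE bE0).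
have mA : measurable [set w | b (Y w)].
  have := measurableT_comp mb measurable_response.
  by move=> /(_ measurableT [set true]); rewrite setTI; exact.
rewrite -[X in P _ _ X]setIT -integral_indic//.
apply: eq_integral => w _; rewrite indicE.
by rewrite (_ : (w \in _) = b (Y w))//; apply/idP/idP => [/set_mem|bw]; [|exact: mem_set].
Qed.

(** An affine functional of the response is normal, with standard deviation
    sqrt(sigma2) |r|. *)
Lemma scaled_variance_response beta sigma2 (r : 'cV[R]_n) (t : R) :
  (0 < sigma2)%R -> r != 0%R ->
  scaled_variance (P beta sigma2) sigma2 (fun w => dotv r (Y w) - t)%R =
  (gauss_sqr * dotv r r)%R.
Proof.
move=> s0 r0; have ss0 : (0 < Num.sqrt sigma2)%R by rewrite sqrtr_gt0.
set Z := fun w => _; set k := (Num.sqrt sigma2 * Num.sqrt (dotv r r))%R.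
set a := (dotv r (X *m beta) - t)%R.
have mdr : measurable_fun setT (fun y : 'cV[R]_n => dotv r y).
  by apply: measurable_dotv => //; exact: measurable_cst.
have ge0_law (f : R -> \bar R) : measurable_fun setT f -> (forall x, 0 <= f x) ->
    \int[P beta sigma2]_w f (Z w) = \int[gauss]_x f (a + k * x)%R.
  move=> mf f0.
  have mfa : measurable_fun setT (fun x => f (a + Num.sqrt sigma2 * x)%R).
    by apply: measurableT_comp => //; apply: measurable_funD => //; exact: measurable_funM.
  rewrite (ge0_integral_response _ (f := fun y => f (dotv r y - t)%R))//; last first.
    by apply: measurableT_comp => //; exact: measurable_funB.
  have := std_gaussian_dotv noise_law_std r0 mfa (fun x => f0 _).
  under [X in _ = X -> _]eq_integral do rewrite mulrA -/k.
  move=> <-; apply: eq_integral => y _; congr f.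
  by rewrite dotvDr dotvZr /a addrAC.
have mZ : measurable_fun setT (fun w => (Z w)%:E).
  apply/measurable_EFinP; apply: measurable_funB => //.
  exact: measurableT_comp mdr measurable_response.
have mean : \int[P beta sigma2]_w (Z w)%:E = a%:E.
  rewrite -(integral_gauss_affine a k) [LHS]integralE [RHS]integralE; congr (_ - _).
    rewrite (eq_integral (fun w => maxe (Z w)%:E 0)); last by move=> w _; rewrite funeposE.
    rewrite (ge0_law (fun x => maxe x%:E 0)).
    - by apply: eq_integral => x _; rewrite funeposE.
    - by apply: measurable_maxe.
    - by move=> x; rewrite le_max lexx orbT.
  rewrite (eq_integral (fun w => maxe (- (Z w)%:E) 0)); last by move=> w _; rewrite funenegE.
  rewrite (ge0_law (fun x => maxe (- x%:E) 0)).
  - by apply: eq_integral => x _; rewrite funenegE.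
  - by apply: measurable_maxe => //; exact: measurableT_comp.
  - by move=> x; rewrite le_max lexx orbT.
rewrite /scaled_variance /variance unlock unlock mean /=.
rewrite (_ : \int[P beta sigma2]_w _ = (k ^+ 2 * gauss_sqr)%:E).
  rewrite /= exprMn !sqr_sqrtr ?dotv_ge0 ?(ltW s0)//.
  by field; rewrite gt_eqF.
rewrite EFinM -gauss_sqrE -ge0_integralZl//; last 3 first.
- by apply/measurable_EFinP; exact: measurable_funX.
- by move=> x _; rewrite lee_fin sqr_ge0.
- by rewrite lee_fin sqr_ge0.
pose f x : \bar R := ((x - a) ^+ 2)%:E.
transitivity (\int[P beta sigma2]_w f (Z w)).
  by apply: eq_integral => w _; rewrite /f expr2.
rewrite ge0_law.
- by apply: eq_integral => x _; rewrite /f addrC addKr exprMn EFinM.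
- by apply/measurable_EFinP; apply: measurable_funX; exact: measurable_funB.
- by move=> x; rewrite lee_fin sqr_ge0.
Qed.

End noise.

(** * The residual standard deviation and the class F *)

Section intervals.
Context {R : realType}.

Lemma itv_ind_scale (k c h x : R) : 0 < k -> itv_ind (k * c) (k * h) (k * x) = itv_ind c h x.
Proof.
move=> k0; rewrite /itv_ind; congr ((nat_of_bool _)%:R).
by rewrite -mulrBr normrM (gtr0_norm k0) ler_pM2l.
Qed.

Lemma lebesgue_centered_itv (c h : R) : 0 <= h ->
  lebesgue_measure [set` centered_itv c h] = (2 * h)%:E.
Proof.
move=> h0; rewrite lebesgue_measure_itv/= lte_fin.
have [hlt|] := ltP (c - h) (c + h); first by rewrite -EFinB; congr EFin; ring.
by move=> hge; congr EFin; lra.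
Qed.

Lemma in_centered_itv (theta c h : R) :
  (theta \in centered_itv c h) = (`|theta - c| <= h).
Proof. by rewrite /centered_itv in_itv/= ler_distl. Qed.

End intervals.

Section class_measurability.
Context {R : realType} (tm d : R) (b s : R -> R).
Hypothesis bsF : class_F tm d b s.

Lemma class_F_measurable_b : measurable_fun setT b.
Proof.
by have [_ [[D [finD cD]] _ _ _]] := bsF; exact: measurable_fun_finite_discontinuity finD cD.
Qed.

(** The function x |-> s |x| inherits continuity off the finite set of points
    x with |x| exceptional; the one-sided continuity of s at 0 suffices because
    |x| approaches 0 from the right. *)
Lemma class_F_measurable_s : measurable_fun setT (fun x : R => s `|x|).
Proof.
have [_ [_ [D [finD cD]] _ _]] := bsF.
apply: (@measurable_fun_finite_discontinuity _ _ (D `|` (-%R @` D))).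
  by rewrite finite_setU; split => //; exact: finite_image.
move=> x xD; have nD : ~ D `|x|.
  move=> Dx; apply: xD; have [x0|x0] := leP 0 x; [left|right].
    by move: Dx; rewrite ger0_norm.
  by exists (- x); rewrite ?opprK//; move: Dx; rewrite ltr0_norm.
have := cD `|x| (normr_ge0 x) nD; apply: cvg_comp.
move=> U hU.
have h : nbhs x (fun y : R => `[0, +oo[%classic `|y| -> U `|y|).
  exact: (@norm_continuous R R^o x _ hU).
change (nbhs x (fun y : R => U `|y|)); apply: filterS h => y; apply.
by rewrite /= in_itv/= andbT.
Qed.

Lemma class_F_tm_gt0 : 0 < d -> 0 < tm.
Proof.
have [[_ s0 _ _] [_ _ _ sd]] := bsF.
by move=> d0; rewrite -(sd d (lexx d)); exact/s0/ltW.
Qed.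

Lemma class_F_out (x : R) : 0 < d -> d <= `|x| -> b x = 0 /\ s `|x| = tm.
Proof.
have [_ [_ _ b0 sd]] := bsF => d0 dx; split; first exact: b0.
exact: sd.
Qed.

End class_measurability.

Section sigmahat.
Context {R : realType} {n p : nat}.
Variables (X : 'M[R]_(n, p)) (bhat : 'cV[R]_n -> 'cV[R]_p).
Hypotheses (ltpn : (p < n)%N) (Xfree : row_free X^T) (bhatP : is_least_squares X bhat).

Local Notation S := (sigmahat X bhat).

Let m_gt0 : 0 < (n - p)%:R :> R.
Proof. by rewrite ltr0n subn_gt0. Qed.

Lemma sigmahat_ge0 y : 0 <= S y. Proof. exact: sqrtr_ge0. Qed.

Lemma sigmahat_shift y beta : S (y + X *m beta) = S y.
Proof.
by rewrite /sigmahat -!/(resid X bhat _) resid_shift.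
Qed.

Lemma sigmahat_shift_dual y k a : S (y + k *: lsq_dual X a) = S y.
Proof. by rewrite /sigmahat -!/(resid X bhat _) resid_shift_dual. Qed.

Lemma sigmahat_scale k y : 0 <= k -> S (k *: y) = k * S y.
Proof.
move=> k0; rewrite /sigmahat -!/(resid X bhat _) resid_scale// dotvZl dotvZr.
by rewrite mulrA -mulrA sqrtrM ?mulr_ge0// -expr2 sqrtr_sqr ger0_norm.
Qed.

Lemma measurable_sigmahat : measurable_fun setT S.
Proof.
have mres : measurable_fun setT (resid X bhat).
  rewrite (_ : resid X bhat = fun y => y + (- X) *m (lsq_mx X *m y)).
    by apply: measurable_column_add => //; do 2! apply: measurable_column_mul => //.
  by apply/funext => y; rewrite /resid mulNmx (bhatE Xfree bhatP).
have mfrac : measurable_fun setT (fun y =>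
    dotv (resid X bhat y) (resid X bhat y) / (n - p)%:R).
  by apply: measurable_funM => //; exact: measurable_dotv.
exact: (measurableT_comp (continuous_measurable_fun (@sqrt_continuous R)) mfrac).
Qed.

(** A vector e orthogonal to the columns of X pairs with y as it does with the
    residual. *)
Lemma sigmahat_eq0 e y : X^T *m e = 0 -> S y = 0 -> dotv e y = 0.
Proof.
move=> Xe; rewrite /sigmahat -!/(resid X bhat _) => /eqP.
rewrite sqrtr_eq0 pmulr_lle0 ?invr_gt0// => r0.
have /eqP : dotv (resid X bhat y) (resid X bhat y) = 0.
  by apply/eqP; rewrite eq_le r0 dotv_ge0.
by rewrite dotv_eq0 => /eqP; exact: resid_eq0_dotv.
Qed.

(** The zero vector is a competitor of the least squares estimate, and
    n - p >= 1. *)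
Lemma sigmahat_sqr_le y : S y ^+ 2 <= dotv y y.
Proof.
rewrite /sigmahat -!/(resid X bhat _) sqr_sqrtr ?divr_ge0 ?dotv_ge0//.
apply: le_trans (dotv_resid_le bhatP y).
rewrite ler_pdivrMr// ler_peMr ?dotv_ge0//.
by rewrite ler1n subn_gt0.
Qed.

Section law.
Local Open Scope ereal_scope.
Variable mu : probability 'cV[R]_n R.
Hypothesis muN : std_gaussian mu.
Notation gauss := (normal_prob (0 : R) 1).
Notation leb := (@lebesgue_measure R).

Lemma std_gaussian_hyperplane (e : 'cV[R]_n) : e != 0%R ->
  {ae mu, forall y, dotv e y != 0%R}.
Proof.
move=> e0.
have mdot : measurable_fun setT (fun y : 'cV[R]_n => dotv e y).
  by apply: measurable_dotv => //; exact: measurable_cst.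
have m0 : measurable [set 0%R : R] by exact: measurable_set1.
have mN : measurable [set y : 'cV[R]_n | dotv e y = 0%R].
  by have := mdot measurableT _ m0; rewrite setTI.
exists [set y | dotv e y = 0%R]; split => //; last first.
  by move=> y /= /negP; rewrite negbK => /eqP.
have kpos : (0 < Num.sqrt (dotv e e))%R.
  by rewrite sqrtr_gt0 lt_neqAle dotv_ge0 eq_sym dotv_eq0 e0.
have mi : measurable_fun setT (fun x : R => (\1_[set 0%R] x)%:E : \bar R).
  by apply/measurable_EFinP; exact: (measurable_indic m0).
rewrite -[X in mu X]setIT -integral_indic//.
transitivity (\int[mu]_y (\1_[set 0%R] (dotv e y) : R)%:E).
  by apply: eq_integral => y _; rewrite !indicE.
rewrite (std_gaussian_dotv muN e0 mi)//.
rewrite ge0_integral_std_normal//; last first.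
  by apply: (measurableT_comp mi); exact: measurable_funM.
rewrite -[RHS](@integral_phi_null _ [set 0%R] _ 0%R m0 _ kpos); last exact: lebesgue_measure_set1.
by apply: eq_integral => x _; rewrite addr0 EFinM.
Qed.

(** There is a direction orthogonal to the columns of X because p < n; the
    residual can vanish only on the hyperplane orthogonal to it, which is
    null. *)
Lemma sigmahat_ae_gt0 : {ae mu, forall y, (0 < S y)%R}.
Proof.
have [e e0 Xe] := orthogonal_column_exists X ltpn.
apply: filterS (std_gaussian_hyperplane e0) => y ey.
rewrite lt_neqAle sigmahat_ge0 andbT eq_sym.
by apply: contra_neq ey; exact: sigmahat_eq0.
Qed.

Lemma sigmahat_sqr_lty : \int[mu]_y (S y ^+ 2)%:E < +oo.
Proof.
have mS2 : measurable_fun setT (fun y : 'cV[R]_n => (S y ^+ 2)%:E).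
  by apply/measurable_EFinP; apply: measurable_funX; exact: measurable_sigmahat.
apply: (@le_lt_trans _ _ (\int[mu]_y \sum_(i < n) (y i 0%R ^+ 2)%:E)).
  apply: ge0_le_integral => //.
  - by move=> y _; rewrite lee_fin sqr_ge0.
  - apply: emeasurable_sum => i; apply/measurable_EFinP; apply: measurable_funX.
    exact: measurable_coord.
  - move=> y _; rewrite sumEFin lee_fin; apply: le_trans (sigmahat_sqr_le y) _.
    by rewrite dotvE; apply: ler_sum => i _; rewrite expr2.
rewrite ge0_integral_sum//; last 2 first.
- move=> i; apply/measurable_EFinP; apply: measurable_funX; exact: measurable_coord.
- by move=> i y _; rewrite lee_fin sqr_ge0.
apply: lte_sum_pinfty => i _.
have d0 : (delta_mx i 0%R : 'cV[R]_n) != 0%R.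
  by rewrite -dotv_eq0 dotv_delta mxE !eqxx oner_eq0.
have msq : measurable_fun setT (fun x : R => (x ^+ 2)%:E).
  by apply/measurable_EFinP; exact: measurable_funX.
have sq0 (x : R) : 0 <= (x ^+ 2)%:E by rewrite lee_fin sqr_ge0.
have -> : \int[mu]_y (y i 0%R ^+ 2)%:E = (gauss_sqr : R)%:E; last exact: ltry.
rewrite -gauss_sqrE.
transitivity (\int[mu]_y (dotv (delta_mx i 0%R) y ^+ 2)%:E).
  by apply: eq_integral => y _; rewrite dotv_delta.
rewrite (std_gaussian_dotv muN d0 msq sq0) dotv_delta mxE !eqxx sqrtr1.
by apply: eq_integral => x _; rewrite mul1r.
Qed.

End law.
End sigmahat.

(** * Coverage and expected length *)

Section response_intervals.
Local Open Scope ereal_scope.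
Context {disp : measure_display} {Omega : measurableType disp} {R : realType}
  {n p : nat}.
Variables (X : 'M[R]_(n, p)) (P : 'cV[R]_p -> R -> probability Omega R)
  (Y : Omega -> 'cV[R]_n) (bhat : 'cV[R]_n -> 'cV[R]_p).
Hypotheses (Xfree : row_free X^T) (bhatP : is_least_squares X bhat)
  (YP : linear_regression X P Y).
Notation mu := (noise_law YP).
Notation resp beta sigma2 y := (X *m beta + Num.sqrt sigma2 *: y)%R.

Let mdotl (r : 'cV[R]_n) : measurable_fun setT (fun y : 'cV[R]_n => dotv r y).
Proof. by apply: measurable_dotv => //; exact: measurable_cst. Qed.

Lemma coverage_response beta sigma2 a (cc h : 'cV[R]_n -> R) : (0 < sigma2)%R ->
  measurable_fun setT cc -> measurable_fun setT h ->
  coverage (P beta sigma2)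
    (fun w => centered_itv (Thetahat bhat a (Y w) - cc (Y w)) (h (Y w)))
    (dotv a beta) =
  \int[mu]_y (itv_ind (cc (resp beta sigma2 y)) (h (resp beta sigma2 y))
                  (Num.sqrt sigma2 * dotv (lsq_dual X a) y))%:E.
Proof.
move=> s0 mc mh; rewrite /coverage.
pose b y := (`|dotv (lsq_dual X a) y - dotv a beta - cc y| <= h y)%R.
have mb : measurable_fun setT b.
  apply: measurable_fun_ler => //; apply: measurableT_comp => //.
  apply: measurable_funB => //; apply: measurable_funB => //; exact: mdotl.
rewrite (_ : [set w | _] = [set w | b (Y w)]).
  rewrite (probability_response YP beta s0 mb); apply: eq_integral => y _.
  rewrite /b /itv_ind dotvDr dotvZr lsq_dual_mulmx//.
  by rewrite [(dotv a beta + _)%R]addrC addrK.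
have swap (u v k : R) : `|u - (v - k)|%R = `|v - u - k|%R by rewrite distrC addrAC.
by apply/seteqP; split => w /=; rewrite in_centered_itv /b /Thetahat
  (dotv_bhat Xfree bhatP) swap.
Qed.

Lemma expected_length_response beta sigma2 (cc h : 'cV[R]_n -> R) : (0 < sigma2)%R ->
  measurable_fun setT h -> (forall y, 0 <= h y)%R ->
  expected_length (P beta sigma2) (fun w => centered_itv (cc (Y w)) (h (Y w))) =
  \int[mu]_y (2 * h (resp beta sigma2 y))%:E.
Proof.
move=> s0 mh h0; rewrite /expected_length.
under eq_integral do rewrite lebesgue_centered_itv//.
apply: (ge0_integral_response YP beta s0 (f := fun y => (2 * h y)%:E)).
- by apply/measurable_EFinP; exact: measurable_funM.
- by move=> y; rewrite lee_fin mulr_ge0.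
Qed.

End response_intervals.

(** Resample along r: S is constant on such lines, so the ratio is a nonconstant
    affine function of a standard normal variable and avoids null sets. *)
Lemma ae_affine_ratio (R : realType) (n : nat) (mu : probability 'cV[R]_n R)
    (r : 'cV[R]_n) (S : 'cV[R]_n -> R) (alpha sigma k : R) (A : R -> Prop) :
  std_gaussian mu -> r != 0 -> measurable_fun setT S ->
  (forall y l, S (y + l *: r) = S y) -> 0 < sigma -> 0 < k ->
  {ae @lebesgue_measure R, forall x, A x} ->
  {ae mu, forall y, 0 < S y -> A ((alpha + sigma * dotv r y) / (S y * k))}.
Proof.
move=> muN r0 mS Sr sigma0 k0 [N [mN N0 AN]].
set f := fun y => (alpha + sigma * dotv r y) / (S y * k).
have mf : measurable_fun setT f.
  apply: measurable_fun_div; last exact: measurable_funM.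
  apply: measurable_funD => //; apply: measurable_funM => //.
  by apply: measurable_dotv => //; exact: measurable_cst.
have mpos : measurable_fun setT (fun y => 0 < S y) by exact: measurable_fun_ltr.
pose B := [set y | 0 < S y] `&` f @^-1` N.
have mB : measurable B.
  apply: measurableI.
    by move: (mpos) => /(_ measurableT [set true]); rewrite setTI; exact.
  by rewrite -[X in measurable X]setTI; exact: mf.
exists B; split => //; last first.
  move=> y /= /not_implyP[Sy nA]; split => //.
  by apply: AN.
pose rho := Num.sqrt (dotv r r).
have rr0 : 0 < dotv r r by rewrite lt_neqAle dotv_ge0 eq_sym dotv_eq0 r0.
have rho0 : 0 < rho by rewrite sqrtr_gt0.
have rho2 : rho ^+ 2 = dotv r r by rewrite sqr_sqrtr// dotv_ge0.
pose q := rho^-1 *: r.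
have q1 : dotv q q = 1 by rewrite dotvZl dotvZr -rho2; field; rewrite gt_eqF.
have mind : measurable_fun setT (fun y => (\1_B y : R)%:E).
  by apply/measurable_EFinP; exact: (measurable_indic mB).
rewrite -[X in mu X]setIT -integral_indic// (std_gaussian_resample muN q1 mind); last first.
  by move=> y; rewrite lee_fin.
apply: integral0_eq => y _.
have Sl l : S (y + (l - dotv q y) *: q) = S y by rewrite scalerA Sr.
have fl l : f (y + (l - dotv q y) *: q) =
    (sigma * rho / (S y * k)) * l + alpha / (S y * k).
  rewrite /f Sl dotvDr dotvZr (_ : dotv r q = rho); last first.
    by rewrite dotvZr -rho2; field; rewrite gt_eqF.
  rewrite (_ : dotv q y = rho^-1 * dotv r y); last exact: dotvZl.
  rewrite (_ : dotv r y + _ = rho * l); last by field; rewrite gt_eqF.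
  by rewrite mulrDl addrC; congr (_ + _); rewrite !mulrA mulrAC.
have [Sy|Sy] := ltP 0 (S y); last first.
  apply: integral0_eq => l _; rewrite indicE memNset ?mul0e//.
  by move=> [/=]; rewrite Sl ltNge Sy.
have k'0 : 0 < sigma * rho / (S y * k) by rewrite divr_gt0 ?mulr_gt0.
rewrite -[RHS](integral_phi_null (alpha / (S y * k)) mN N0 k'0).
apply: eq_integral => l _; rewrite EFinM; congr (_%:E * _)%E.
rewrite !indicE; congr ((nat_of_bool _)%:R).
apply/idP/idP => /set_mem.
  by move=> [_ /=]; rewrite fl => h; exact: mem_set.
by move=> h; apply: mem_set; split => /=; rewrite ?Sl ?fl.
Qed.

(** * Admissibility of the usual interval *)

Theorem theorem1 (R : realType) (n p : nat) (ltpn : (p < n)%N)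
    (X : 'M[R]_(n, p)) (Xfree : row_free X^T)
    (disp : measure_display) (Omega : measurableType disp)
    (P : 'cV[R]_p -> R -> probability Omega R) (Y : Omega -> 'cV[R]_n)
    (YP : linear_regression X P Y)
    (bhat : 'cV[R]_n -> 'cV[R]_p) (bhatP : is_least_squares X bhat)
    (a : 'cV[R]_p) (a0 : a != 0)
    (alpha : R) (alpha01 : 0 < alpha < 1)
    (tm : R) (tmP : student_prob (n - p) `[- tm, tm] = (1 - alpha)%:E) :
  ~ exists (c : 'cV[R]_p) (t d : R) (b s : R -> R),
    let theta beta := dotv a beta in
    let v11 beta sigma2 :=
      scaled_variance (P beta sigma2) sigma2 (Thetahat bhat a \o Y) in
    let v22 beta sigma2 :=
      scaled_variance (P beta sigma2) sigma2 (tauhat bhat c t \o Y) in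
    let I beta sigma2 w := usual_ci X bhat a (v11 beta sigma2) tm (Y w) in
    let J beta sigma2 w :=
      modified_ci X bhat a c t (v11 beta sigma2) (v22 beta sigma2) b s (Y w) in
    let lenI beta sigma2 :=
      expected_length (P beta sigma2) (I beta sigma2) in
    let lenJ beta sigma2 :=
      expected_length (P beta sigma2) (J beta sigma2) in
    let covI beta sigma2 :=
      coverage (P beta sigma2) (I beta sigma2) (theta beta) in
    let covJ beta sigma2 :=
      coverage (P beta sigma2) (J beta sigma2) (theta beta) in
    [/\ free [:: a; c], 0 < d & class_F tm d b s] /\
    [/\ (forall (beta : 'cV[R]_p) (sigma2 : R), 0 < sigma2 ->
           (lenJ beta sigma2 <= lenI beta sigma2)%E),
        (forall (beta : 'cV[R]_p) (sigma2 : R), 0 < sigma2 ->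
           (covI beta sigma2 <= covJ beta sigma2)%E)
      & (exists (beta : 'cV[R]_p) (sigma2 : R), 0 < sigma2 /\
           ((lenJ beta sigma2 < lenI beta sigma2)%E \/
            (covI beta sigma2 < covJ beta sigma2)%E))].
Proof.
case=> c [t [d [b [s]]]] /=.
move=> [[fac d0 bsF] [len cov [be [s2 [s20 strict]]]]].
have [v av cv] := free2_dual fac.
have c0 : c != 0.
  by move: fac; rewrite free_cons seq1_free => /andP[].
have tm0 := class_F_tm_gt0 bsF d0.
have mb := class_F_measurable_b bsF.
have ms := class_F_measurable_s bsF.
have s0 x : 0 < s `|x| by have [[_ sp _ _] _] := bsF; exact: sp.
set mu := noise_law YP; have muN : std_gaussian mu := noise_law_std YP.
set qa := lsq_dual X a; set r := lsq_dual X c.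
have qa0 : qa != 0 by exact: lsq_dual_neq0.
have r0 : r != 0 by exact: lsq_dual_neq0.
pose V1 := gauss_sqr * dotv qa qa; pose V2 := gauss_sqr * dotv r r.
have v11E beta sigma2 : 0 < sigma2 ->
    scaled_variance (P beta sigma2) sigma2 (Thetahat bhat a \o Y) = V1.
  move=> sp; rewrite -[RHS](scaled_variance_response YP beta 0 sp qa0).
  congr scaled_variance; apply/funext => w /=.
  by rewrite /Thetahat (dotv_bhat Xfree bhatP) subr0.
have v22E beta sigma2 : 0 < sigma2 ->
    scaled_variance (P beta sigma2) sigma2 (tauhat bhat c t \o Y) = V2.
  move=> sp; rewrite -[RHS](scaled_variance_response YP beta t sp r0).
  congr scaled_variance; apply/funext => w /=.
  by rewrite /tauhat (dotv_bhat Xfree bhatP).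
pose sh := sigmahat X bhat; pose th := tauhat bhat c t.
pose k2 := Num.sqrt V2; pose rV1 := Num.sqrt V1.
pose xr y := th y / (sh y * k2).
pose cJ y := rV1 * sh y * b (xr y).
pose hJ y := rV1 * sh y * s `|xr y|.
pose hI y := tm * rV1 * sh y.
have k20 : 0 < k2.
  by rewrite sqrtr_gt0 mulr_gt0 ?gauss_sqr_gt0// lt_neqAle dotv_ge0 eq_sym dotv_eq0 r0.
have msh : measurable_fun setT sh by exact: measurable_sigmahat.
have sh0 y : 0 <= sh y by exact: sigmahat_ge0.
have mth : measurable_fun setT th.
  rewrite (_ : th = fun y => dotv r y - t).
    by apply: measurable_funB => //; apply: measurable_dotv => //; exact: measurable_cst.
  by apply/funext => y; rewrite /th /tauhat (dotv_bhat Xfree bhatP).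
have mxr : measurable_fun setT xr.
  by apply: measurable_fun_div => //; exact: measurable_funM.
have mcJ : measurable_fun setT cJ.
  apply: measurable_funM; first exact: measurable_funM.
  exact: measurableT_comp.
have mhJ : measurable_fun setT hJ.
  apply: measurable_funM; first exact: measurable_funM.
  exact: (measurableT_comp ms mxr).
have mhI : measurable_fun setT hI by exact: measurable_funM.
have hJ0 y : 0 <= hJ y by rewrite !mulr_ge0 ?sqrtr_ge0// ltW.
have hI0 y : 0 <= hI y by rewrite !mulr_ge0 ?sqrtr_ge0// ltW.
have JE beta sigma2 : 0 < sigma2 ->
    (fun w => modified_ci X bhat a c t
       (scaled_variance (P beta sigma2) sigma2 (Thetahat bhat a \o Y))
       (scaled_variance (P beta sigma2) sigma2 (tauhat bhat c t \o Y)) b s (Y w)) =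
    (fun w => centered_itv (Thetahat bhat a (Y w) - cJ (Y w)) (hJ (Y w))).
  move=> sp; apply/funext => w; rewrite /modified_ci v11E// v22E//.
  congr (centered_itv _ (_ * s _)).
  by rewrite /xr normrM normfV [`|_ * k2|]ger0_norm// mulr_ge0// ltW.
have IE beta sigma2 : 0 < sigma2 ->
    (fun w => usual_ci X bhat a
       (scaled_variance (P beta sigma2) sigma2 (Thetahat bhat a \o Y)) tm (Y w)) =
    (fun w => centered_itv (Thetahat bhat a (Y w) - cst 0 (Y w)) (hI (Y w))).
  by move=> sp; apply/funext => w; rewrite /usual_ci v11E// /= subr0.
pose resp beta sigma2 y := X *m beta + Num.sqrt sigma2 *: (y : 'cV[R]_n).
have {len} len beta sigma2 : 0 < sigma2 ->
    (\int[mu]_y (2 * hJ (resp beta sigma2 y))%:E <= \int[mu]_y (2 * hI (resp beta sigma2 y))%:E)%E.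
  move=> sp; have := len beta sigma2 sp.
  rewrite JE// IE//.
  rewrite (expected_length_response YP beta (fun y => Thetahat bhat a y - cJ y) sp mhJ hJ0).
  by rewrite (expected_length_response YP beta (fun y => Thetahat bhat a y - cst 0 y) sp mhI hI0).
have mc0 : measurable_fun setT (cst 0 : 'cV[R]_n -> R) by exact: measurable_cst.
have {cov} cov beta sigma2 : 0 < sigma2 ->
    (\int[mu]_y (itv_ind 0 (hI (resp beta sigma2 y)) (Num.sqrt sigma2 * dotv qa y))%:E <=
     \int[mu]_y (itv_ind (cJ (resp beta sigma2 y)) (hJ (resp beta sigma2 y))
        (Num.sqrt sigma2 * dotv qa y))%:E)%E.
  move=> sp; have := cov beta sigma2 sp.
  rewrite JE// IE// (coverage_response Xfree bhatP YP beta a sp mcJ mhJ).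
  by rewrite (coverage_response Xfree bhatP YP beta a sp mc0 mhI).
pose na := Num.sqrt (dotv qa qa).
have aa0 : 0 < dotv qa qa by rewrite lt_neqAle dotv_ge0 eq_sym dotv_eq0 qa0.
have na0 : 0 < na by rewrite sqrtr_gt0.
have na2 : na ^+ 2 = dotv qa qa by rewrite sqr_sqrtr// ltW.
pose q := na^-1 *: qa.
have q1 : dotv q q = 1 by rewrite dotvZl dotvZr -na2; field; rewrite gt_eqF.
have qaE y : dotv qa y = na * dotv q y.
  by rewrite dotvZl mulrA divff ?mul1r// gt_eqF.
pose k1 : R := Num.sqrt gauss_sqr.
have k10 : 0 < k1 by rewrite sqrtr_gt0 gauss_sqr_gt0.
have rV1E : rV1 = na * k1 by rewrite /rV1 /V1 sqrtrM 1?mulrC// ltW// gauss_sqr_gt0.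
have sh_resp beta sigma2 y : sh (resp beta sigma2 y) = Num.sqrt sigma2 * sh y.
  rewrite /sh /resp addrC (sigmahat_shift Xfree bhatP).
  by rewrite (sigmahat_scale Xfree bhatP)// sqrtr_ge0.
have th_resp beta sigma2 y :
    th (resp beta sigma2 y) = dotv c beta - t + Num.sqrt sigma2 * dotv r y.
  rewrite /th /tauhat (dotv_bhat Xfree bhatP) -/r /resp dotvDr dotvZr.
  by rewrite lsq_dual_mulmx// addrAC.
have xr_resp u y : xr (resp (u *: v) 1 y) = (dotv r y - t + u) / (sh y * k2).
  rewrite /xr sh_resp th_resp sqrtr1 !mul1r dotvZr cv mulr1.
  by congr (_ / _); ring.
(* The line beta = u v with sigma = 1: there theta = 0, and dividing the error,
   the centers and the half-widths by |qa| gives the normalized comparison. *)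
have rigid : {ae lebesgue_measure, forall x : R, b x = 0 /\ s `|x| = tm}.
  apply: (@interval_rigidity R n mu muN q sh (fun y => dotv r y - t) q1 msh _ sh0 _ _ _
    k1 k2 tm d b (fun x => s `|x|)) => //.
  - by apply: measurable_funB => //; apply: measurable_dotv => //; exact: measurable_cst.
  - by move=> y l; rewrite scalerA; exact: sigmahat_shift_dual.
  - exact: sigmahat_ae_gt0.
  - exact: sigmahat_sqr_lty.
  - by move=> x; exact: (class_F_out bsF d0).
  - move=> u.
    have scale (f : 'cV[R]_n -> R) : measurable_fun setT f -> (forall y, 0 <= f y) ->
        (\int[mu]_y (2 * (na * f y))%:E = (2 * na)%:E * \int[mu]_y (f y)%:E)%E.
      move=> mf f0; rewrite -ge0_integralZl//.
      - by apply: eq_integral => y _; rewrite -EFinM mulrA.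
      - exact/measurable_EFinP.
      - by move=> y _; rewrite lee_fin.
      - by rewrite lee_fin mulr_ge0// ltW.
    have := len (u *: v) 1 ltr01.
    have hJu y : hJ (resp (u *: v) 1 y) =
        na * (k1 * sh y * s `|(dotv r y - t + u) / (sh y * k2)|).
      by rewrite /hJ xr_resp sh_resp sqrtr1 mul1r rV1E !mulrA.
    have hIu y : hI (resp (u *: v) 1 y) = na * (k1 * sh y * tm).
      by rewrite /hI sh_resp sqrtr1 mul1r rV1E; ring.
    under eq_integral do rewrite hJu.
    under [leRHS]eq_integral do rewrite hIu.
    rewrite !scale.
    + by rewrite lee_pmul2l// lte_fin mulr_gt0.
    + by apply: measurable_funM => //; exact: measurable_funM.
    + by move=> y; rewrite !mulr_ge0// ltW.
    + apply: measurable_funM; first exact: measurable_funM.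
      apply: (measurableT_comp ms); apply: measurable_fun_div.
        apply: measurable_funD => //; apply: measurable_funB => //.
        by apply: measurable_dotv => //; exact: measurable_cst.
      exact: measurable_funM.
    + by move=> y; rewrite !mulr_ge0// ltW.
  - move=> u; have covu := cov (u *: v) 1 ltr01.
    have Iu y : itv_ind 0 (hI (resp (u *: v) 1 y)) (Num.sqrt 1 * dotv qa y) =
        itv_ind 0 (k1 * sh y * tm) (dotv q y).
      rewrite -[RHS](itv_ind_scale _ _ _ na0) mulr0 sqrtr1 mul1r qaE; congr (itv_ind 0 _ _).
      by rewrite /hI sh_resp sqrtr1 mul1r rV1E; ring.
    have Ju y : itv_ind (cJ (resp (u *: v) 1 y)) (hJ (resp (u *: v) 1 y)) (Num.sqrt 1 * dotv qa y) =
        itv_ind (k1 * sh y * b ((dotv r y - t + u) / (sh y * k2)))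
            (k1 * sh y * s `|(dotv r y - t + u) / (sh y * k2)|) (dotv q y).
      rewrite -[RHS](itv_ind_scale _ _ _ na0) sqrtr1 mul1r qaE /cJ /hJ xr_resp sh_resp.
      rewrite sqrtr1 mul1r rV1E.
      by congr (itv_ind _ _ _); rewrite !mulrA.
    apply: (le_trans (le_trans _ covu)); rewrite le_eqVlt; apply/orP; left; apply/eqP.
      by apply: eq_integral => y _; rewrite Iu.
    by apply: eq_integral => y _; rewrite Ju.
(* When sigma-hat = 0 both intervals shrink to Theta-hat; otherwise the ratio
   avoids the exceptional null set. *)
have same : {ae mu, forall y, hJ (resp be s2 y) = hI (resp be s2 y) /\ cJ (resp be s2 y) = 0}.
  have ss0 : 0 < Num.sqrt s2 by rewrite sqrtr_gt0.
  have kk0 : 0 < Num.sqrt s2 * k2 by rewrite mulr_gt0.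
  have Sr y l : sh (y + l *: r) = sh y by exact: sigmahat_shift_dual.
  have := ae_affine_ratio (dotv c be - t) muN r0 msh Sr ss0 kk0 rigid.
  apply: filterS => y hy.
  have [shy|shy] := ltP 0 (sh y); last first.
    have e0 : sh (resp be s2 y) = 0.
      by rewrite sh_resp (_ : sh y = 0) ?mulr0//; apply/eqP; rewrite eq_le shy sh0.
    by rewrite /hJ /hI /cJ e0 !mulr0 !mul0r.
  have := hy shy.
  have -> : (dotv c be - t + Num.sqrt s2 * dotv r y) / (sh y * (Num.sqrt s2 * k2)) =
      xr (resp be s2 y).
    by rewrite /xr sh_resp th_resp mulrA [sh y * _]mulrC.
  by rewrite /hJ /hI /cJ => -[-> ->]; split; [ring|rewrite mulr0].
have mresp : measurable_fun setT (resp be s2).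
  apply: measurable_column_add; first exact: measurable_cst.
  by apply: measurable_column_scale => //; exact: measurable_cst.
have mhJr : measurable_fun setT (fun y => hJ (resp be s2 y)) by exact: measurableT_comp mhJ mresp.
have mhIr : measurable_fun setT (fun y => hI (resp be s2 y)) by exact: measurableT_comp mhI mresp.
have mcJr : measurable_fun setT (fun y => cJ (resp be s2 y)) by exact: measurableT_comp mcJ mresp.
have mdqa : measurable_fun setT (fun y => Num.sqrt s2 * dotv qa y).
  by apply: measurable_funM => //; apply: measurable_dotv => //; exact: measurable_cst.
move: strict; rewrite JE// IE//.
rewrite (expected_length_response YP be (fun y => Thetahat bhat a y - cJ y) s20 mhJ hJ0).
rewrite (expected_length_response YP be (fun y => Thetahat bhat a y - cst 0 y) s20 mhI hI0).
rewrite (coverage_response Xfree bhatP YP be a s20 mcJ mhJ).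
rewrite (coverage_response Xfree bhatP YP be a s20 mc0 mhI) -/mu -/qa.
case=> /lt_eqF/eqP; apply.
- apply: ae_eq_integral => //.
  + by apply/measurable_EFinP; exact: measurable_funM.
  + by apply/measurable_EFinP; exact: measurable_funM.
  + by apply: filterS same => y [hJI _] _; rewrite -!/(resp _ _ _) hJI.
- apply: ae_eq_integral => //.
  + by apply/measurable_EFinP; exact: measurable_itv_ind.
  + by apply/measurable_EFinP; exact: measurable_itv_ind.
  + by apply: filterS same => y [hJI cJ0] _; rewrite -!/(resp _ _ _) hJI cJ0.
Qed.
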